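(* Let $m$ be a dimension and let $r_0>0$, $\beta\in(0,1)$, $C>0$, $V_0>0$, $D_0>0$. Let $(M_i^m)_{i\in\mathbb{N}}$ be a sequence of compact $m$-dimensional Riemannian manifolds such that $\operatorname{Vol}(M_i)\le V_0$ and $\operatorname{Diam}(M_i)\le D_0$ for all $i$. Suppose that either every $M_i$ has the $m$-dimensional $C,\beta$-tetrahedral property at every point $p\in M_i$ for every radius $r\in(0,r_0]$, or every $M_i$ has the $m$-dimensional integral $C,\beta$-tetrahedral property at every point $p\in M_i$ for every radius $r\in(0,r_0]$. Then a subsequence of $(M_i)$ converges in the Gromov-Hausdorff sense. In particular, the $M_i$ have a uniform upper bound on diameter depending only on the constants $r_0,\beta,C,V_0$ (and the dimension $m$).
   Context: Riemannian manifolds are connected and carry the Riemannian distance $d$; $B_p(r)$ is the open ball, $\operatorname{Vol}$ is Riemannian volume and $\operatorname{Diam}$ is the diameter. Here $m\ge 2$. Let $X$ be a metric space with metric completion $\bar X$, let $\rho_q(x)=d(x,q)$, let $p\in X$, $r>0$, and let $p_1,\dots,p_{m-1}\in\partial B_p(r)\subset\bar X$. Put $$P(p,r,t_1,\dots,t_{m-1})=\rho_p^{-1}(r)\cap\rho_{p_1}^{-1}(t_1)\cap\cdots\cap\rho_{p_{m-1}}^{-1}(t_{m-1}),$$ $$h(p,r,t_1,\dots,t_{m-1})=\inf\{d(x,y): x\ne y,\ x,y\in P(p,r,t_1,\dots,t_{m-1})\}$$ when $P(p,r,t_1,\dots,t_{m-1})$ contains at least one pair of distinct points, and $h(p,r,t_1,\dots,t_{m-1})=0$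 otherwise. Given $C>0$ and $\beta\in(0,1)$: - $X$ has the $m$-dimensional $C,\beta$-tetrahedral property at $p$ for radius $r$ if there exist $p_1,\dots,p_{m-1}\in\partial B_p(r)\subset\bar X$ such that $h(p,r,t_1,\dots,t_{m-1})\ge Cr$ for all $(t_1,\dots,t_{m-1})\in[(1-\beta)r,(1+\beta)r]^{m-1}$. - $X$ has the $m$-dimensional integral $C,\beta$-tetrahedral property at $p$ for radius $r$ if there exist $p_1,\dots,p_{m-1}\in\partial B_p(r)\subset\bar X$ such that $$\int_{(1-\beta)r}^{(1+\beta)r}\cdots\int_{(1-\beta)r}^{(1+\beta)r}h(p,r,t_1,\dots,t_{m-1})\,dt_1\cdots dt_{m-1}\ \ge\ C(2\beta)^{m-1}r^m .$$ *)

(* Defs.v *)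
From HB Require Import structures.
From mathcomp Require Import all_boot all_order all_algebra.
From mathcomp Require Import all_classical all_reals all_analysis.

Set Implicit Arguments.
Unset Strict Implicit.
Unset Printing Implicit Defensive.

Import Order.TTheory GRing.Theory Num.Theory.
Import numFieldNormedType.Exports.

Local Open Scope classical_set_scope.
Local Open Scope ring_scope.

(* n-fold iterated Lebesgue integral over the cube D^n.  For nonnegative Borel
   functions it is the integral over D^n with respect to n-dimensional Lebesgue
   measure (Tonelli).  The dimension 1 + n is convertible to n.+1. *)
Fixpoint iterated_integral (R : realType) (n : nat) (D : set R) :
    ('rV[R]_n -> \bar R) -> \bar R :=
  match n return ('rV[R]_n -> \bar R) -> \bar R with
  | 0 => fun f => f 0
  | n'.+1 => fun f =>
      (\int[@lebesgue_measure R]_(x in D)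
         iterated_integral D
           (fun v : 'rV[R]_n' => f (row_mx (const_mx x : 'rV[R]_1) v)))%E
  end.

Section smooth_functions.
Context {R : realType} {m : nat}.
Implicit Types (D : set 'rV[R]_m) (f : 'rV[R]_m -> R).

(* Meaningful for open D: all iterated partial derivatives of order at most k
   exist and are continuous at every point of D. *)
Fixpoint Ck_on (k : nat) D f : Prop :=
  (forall x, D x -> {for x, continuous f}) /\
  match k with
  | 0 => True
  | k'.+1 => forall j : 'I_m,
      (forall x, D x -> derivable f x (delta_mx 0 j)) /\
      Ck_on k' D ('D_(delta_mx 0 j) f)
  end.

Definition smooth_on D f := forall k, Ck_on k D f.

End smooth_functions.

(* Smooth structure without boundary.  [param i] is the inverse of the chart
   [chart i], whose domain is [dom i]; its values outside
   [chart i @` dom i] are irrelevant. *)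
Record smooth_atlas (R : realType) (m : nat) (T : topologicalType) := {
  chart_index : Type;
  dom : chart_index -> set T;
  chart : chart_index -> T -> 'rV[R]_m;
  param : chart_index -> 'rV[R]_m -> T;
  dom_open : forall i, open (dom i);
  dom_cover : forall x, exists i, dom i x;
  codom_open : forall i, open (chart i @` dom i);
  chartK : forall i x, dom i x -> param i (chart i x) = x;
  chart_continuous : forall i x, dom i x -> {for x, continuous (chart i)};
  param_continuous : forall i v,
    (chart i @` dom i) v -> {for v, continuous (param i)};
  transition_smooth : forall i j (k : 'I_m),
    smooth_on (chart i @` (dom i `&` dom j))
              (fun v => chart j (param i v) 0 k) }.

Definition chart_codom (R : realType) (m : nat) (T : topologicalType)
    (A : smooth_atlas R m T) (i : chart_index A) : set 'rV[R]_m :=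
  chart i @` dom i.

(* [gram i v] is the Gram matrix of the metric, in the coordinate basis of the
   chart i, at the point with coordinates v. *)
Record metric_tensor (R : realType) (m : nat) (T : topologicalType)
    (A : smooth_atlas R m T) := {
  gram : chart_index A -> 'rV[R]_m -> 'M[R]_m;
  gram_smooth : forall i (k l : 'I_m),
    smooth_on (chart_codom i) (fun v => gram i v k l);
  gram_sym : forall i v, chart_codom i v -> (gram i v)^T = gram i v;
  gram_posdef : forall i v, chart_codom i v -> forall u : 'rV[R]_m, u != 0 ->
    0 < (u *m gram i v *m u^T) 0 0;
  gram_compat : forall i j v, (chart i @` (dom i `&` dom j)) v ->
    forall u w : 'rV[R]_m,
      u *m gram i v *m w^T =
      'D_u (chart j \o param i) v *m gram j (chart j (param i v))
        *m ('D_w (chart j \o param i) v)^T }.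

Section riemannian_geometry.
Context {R : realType} {m : nat} {T : topologicalType}.
Context {A : smooth_atlas R m T} (g : metric_tensor A).

Definition C1_curve_in (i : chart_index A) (c : R -> 'rV[R]_m) : Prop :=
  [/\ forall t, derivable c t 1,
      continuous (derive1 c) &
      forall t, t \in `[0, 1] -> chart_codom i (c t)].

Definition curve_length (i : chart_index A) (c : R -> 'rV[R]_m) : R :=
  \int[@lebesgue_measure R]_(t in `[0, 1])
    Num.sqrt ((derive1 c t *m gram g i (c t) *m (derive1 c t)^T) 0 0).

(* [piecewise_C1_path x y l]: a piecewise C1 path of length l goes from x to y.
   By compactness of the parameter interval, every such path is a concatenation
   of C1 pieces each lying in a single chart domain.  A piece is given by its
   expression in the chart, which may be taken C1 on the whole line. *)
Inductive piecewise_C1_path : T -> T -> R -> Prop :=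
| path_cst x : piecewise_C1_path x x 0
| path_cat i c y l : C1_curve_in i c ->
    piecewise_C1_path (param i (c 1)) y l ->
    piecewise_C1_path (param i (c 0)) y (curve_length i c + l).

Definition riemannian_dist (x y : T) : \bar R :=
  ereal_inf [set l%:E | l in piecewise_C1_path x y].

(* Volume of a set B contained in the domain of the chart i. *)
Definition chart_volume (i : chart_index A) (B : set T) : \bar R :=
  iterated_integral [set: R] (fun v : 'rV[R]_m =>
    (\1_(chart i @` B) v * Num.sqrt (\det (gram g i v)))%:E).

(* The additive extension of [chart_volume] to Borel sets B: [chart_volume] does
   not depend on the chart, and the supremum is the sum of the volumes of the
   pieces for any countable partition of B into Borel sets each contained in a
   chart domain. *)
Definition riemannian_volume (B : set T) : \bar R :=
  ereal_sup [set s | exists (n : nat) (i : 'I_n -> chart_index A) (E : 'I_n -> set T),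
    [/\ forall k, <<s open >> (E k),
        forall k, E k `<=` B `&` dom (i k),
        trivIset [set: 'I_n] E &
        s = (\sum_(k < n) chart_volume (i k) (E k))%E]].

End riemannian_geometry.

(* Connected Riemannian manifold of dimension m, seen as a metric space: the
   metric, which also gives the topology of the manifold, is the Riemannian
   distance.  Hausdorffness and second countability are then automatic. *)
Record riemannianType (R : realType) (m : nat) := {
  carrier :> metricType R;
  atlas : smooth_atlas R m carrier;
  tensor : metric_tensor atlas;
  carrier_nonempty : [set: carrier] !=set0;
  carrier_connected : connected [set: carrier];
  mdistE : forall x y : carrier,
    (mdist x y)%:E = riemannian_dist tensor x y }.

Definition Vol (R : realType) (m : nat) (M : riemannianType R m) : \bar R :=
  riemannian_volume (tensor M) [set: M].

Definition Diam (R : realType) (X : metricType R) : \bar R :=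
  ereal_sup [set e | exists x y : X, e = (mdist x y)%:E].

Definition isometric (R : realType) (X Y : metricType R) (f : X -> Y) : Prop :=
  forall x y, mdist (f x) (f y) = mdist x y.

Definition is_completion (R : realType) (X Xbar : metricType R)
    (j : X -> Xbar) : Prop :=
  [/\ isometric j, dense (range j) &
      forall F : set_system Xbar, ProperFilter F -> cauchy F ->
        exists l : Xbar, F --> l].

Definition boundary (T : topologicalType) (B : set T) : set T :=
  closure B `\` interior B.

Section tetrahedral.
Context {R : realType} (m : nat).

(* [j : X -> Xbar] is the embedding in the completion; the m - 1 parameters
   t_k form a row vector. *)
Definition tetra_points (X Xbar : metricType R) (j : X -> Xbar) (p : X)
    (q : 'I_m.-1 -> Xbar) (r : R) (t : 'rV[R]_m.-1) : set X :=
  [set x | mdist x p = r /\ forall k, mdist (j x) (q k) = t 0 k].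

Definition tetra_h (X Xbar : metricType R) (j : X -> Xbar) (p : X)
    (q : 'I_m.-1 -> Xbar) (r : R) (t : 'rV[R]_m.-1) : R :=
  let P := tetra_points j p q r t in
  if `[< exists x y, [/\ P x, P y & x <> y] >]
  then inf [set d | exists x y, [/\ P x, P y, x <> y & d = mdist x y]]
  else 0.

Definition tetrahedral_property (C beta : R) (X : metricType R) (p : X) (r : R)
    : Prop :=
  exists (Xbar : metricType R) (j : X -> Xbar) (q : 'I_m.-1 -> Xbar),
    [/\ is_completion j,
        forall k, boundary (ball (j p) r) (q k) &
        forall t : 'rV[R]_m.-1,
          (forall k, t 0 k \in `[(1 - beta) * r, (1 + beta) * r]) ->
          C * r <= tetra_h j p q r t].

Definition integral_tetrahedral_property (C beta : R) (X : metricType R)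
    (p : X) (r : R) : Prop :=
  exists (Xbar : metricType R) (j : X -> Xbar) (q : 'I_m.-1 -> Xbar),
    [/\ is_completion j,
        forall k, boundary (ball (j p) r) (q k) &
        ((C * (2 * beta) ^+ m.-1 * r ^+ m)%:E <=
         iterated_integral `[((1 - beta) * r)%R, ((1 + beta) * r)%R]
           (fun t => (tetra_h j p q r t)%:E))%E].

End tetrahedral.

Definition hausdorff_dist (R : realType) (Z : metricType R) (A B : set Z)
    : \bar R :=
  ereal_inf [set e%:E | e in [set e : R | [/\ 0 < e,
    forall a, A a -> exists2 b, B b & mdist a b < e &
    forall b, B b -> exists2 a, A a & mdist a b < e]]].

Definition gromov_hausdorff_dist (R : realType) (X Y : metricType R) : \bar R :=
  ereal_inf [set e | exists (Z : metricType R) (f : X -> Z) (g : Y -> Z),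
    [/\ isometric f, isometric g &
        e = hausdorff_dist (range f) (range g)]].

Definition gromov_hausdorff_cvg (R : realType) (X : nat -> metricType R)
    (Y : metricType R) : Prop :=
  compact [set: Y] /\
  gromov_hausdorff_dist (X n) Y @[n --> \oo] --> (0 : \bar R).

(* Main.v *)
From HB Require Import structures.
Require Import Defs.
From mathcomp Require Import all_boot all_order all_algebra.
From mathcomp Require Import all_classical all_reals all_analysis.
From mathcomp Require Import measurable_realfun ring lra.

Set Implicit Arguments.
Unset Strict Implicit.
Unset Printing Implicit Defensive.

Import Order.TTheory GRing.Theory Num.Theory.
Import numFieldNormedType.Exports.

Local Open Scope classical_set_scope.
Local Open Scope ring_scope.

(** The tetrahedral hypotheses force the volume of balls to grow at least like
[r ^+ m], with a constant that depends only on [m], [beta] and [C]. Together with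
the upper bound on the volume this limits the number of disjoint balls of any
given radius, and Gromov's precompactness theorem applies; on a connected space
it also limits the diameter.

The lower bound on the volume uses only elementary counting. Let a compact
manifold be covered by finitely many balls of a very small radius [delta] whose
concentric balls of radius [delta / 2] are disjoint. In a chart the distance is
at most the length of straight segments, so a small ball contains an ellipsoid of
volume comparable to [delta ^+ m] ([small_ball_volume]); since the volume is at
most [V0], the cover has at most a multiple of [V0 / delta ^+ m] elements
([separated_volume]).

On the other hand let [S] be the sphere of radius [s] about [p] and consider the
map from [S] to the space of [m - 1] real parameters given by the distances to
the vertices of the tetrahedron. The function [tetra_h] vanishes off the image of
this map and never exceeds [2 * s], so the integral hypothesis, which follows
from the pointwise one, bounds the measure of the image below by a multiple of
[s ^+ m.-1]. A ball of radius [delta] is sent into a cube of side [2 * delta], so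
[S] meets at least a multiple of [(s / delta) ^+ m.-1] balls of the cover
([sphere_covering_count]). Applied to about [r / delta] concentric spheres that
are [2 * delta] apart, this yields a multiple of [(r / delta) ^+ m] balls of the
cover near the ball of radius [r] about [p] ([ball_covering_count]). The vertices
may change with the radius, since each sphere is treated separately. Comparing
the two counts, the scale [delta] cancels ([tetrahedral_packing]).

In [gromov_precompactness] the limit space is the completion of a limit of the
distances between the points of finite nets, and closeness for the
Gromov-Hausdorff distance is obtained by gluing two spaces along a correspondence
of small distortion ([gromov_hausdorff_le]). *)

(** * Lower integrals and iterated integrals *)

(** The integral of a nonnegative function is a supremum over the simple
functions below it, so it is monotone on arbitrary functions. This matters
because neither [tetra_h] nor the indicator of a chart image times the volume
density is known to be measurable; they are only compared with functions that
are. *)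
Lemma le_lower_integral d (T : measurableType d) (R : realType)
    (mu : {measure set T -> \bar R}) (D : set T) (f g : T -> \bar R) :
  (forall x, D x -> 0 <= f x)%E -> (forall x, D x -> f x <= g x)%E ->
  (\int[mu]_(x in D) f x <= \int[mu]_(x in D) g x)%E.
Proof.
move=> f0 fg.
have g0 x : D x -> (0 <= g x)%E by move=> Dx; exact: le_trans (f0 _ Dx) (fg _ Dx).
rewrite !ge0_integralE//; apply: ereal_sup_le => _ [h /= hf <-]; exists h => // x.
apply: le_trans (hf x) _; rewrite /patch; case: ifPn => //; rewrite inE; exact: fg.
Qed.

(** Prepending a coordinate, as [iterated_integral] does. *)
Definition consv (R : realType) (n : nat) (x : R) (v : 'rV[R]_n) : 'rV[R]_(1 + n) :=
  row_mx (const_mx x) v.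

Lemma consv0 (R : realType) (n : nat) (x : R) (v : 'rV[R]_n) :
  consv x v 0 ord0 = x.
Proof.
by rewrite (_ : ord0 = lshift n (0 : 'I_1)) ?row_mxEl ?mxE//; exact: val_inj.
Qed.

Lemma consvS (R : realType) (n : nat) (x : R) (v : 'rV[R]_n) l :
  consv x v 0 (lift ord0 l) = v 0 l.
Proof.
by rewrite (_ : lift ord0 l = rshift 1 l) ?row_mxEr//; exact: val_inj.
Qed.

Lemma iterated_integral_ge0 (R : realType) (n : nat) (D : set R)
    (f : 'rV[R]_n -> \bar R) :
  (forall t, 0 <= f t)%E -> (0 <= iterated_integral D f)%E.
Proof.
elim: n f => [|n IH] f f0 /=; first exact: f0.
by apply: integral_ge0 => x _; apply: IH.
Qed.

(** Induction on the dimension: integrating the inner coordinates turns the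
indicator of the [k]-th cube into the indicator of an interval, with the weight
[w k] multiplied by the volume of a face. The weights are there to carry the
indicator in the outer coordinate through the induction hypothesis. *)
Lemma iterated_integral_le_cubes (R : realType) (D : set R) (I : Type)
    (s : seq I) (delta : R) (n : nat) (w : I -> R) (a : I -> 'rV[R]_n)
    (f : 'rV[R]_n -> \bar R) : measurable D -> 0 <= delta ->
  (forall k, 0 <= w k) -> (forall t, 0 <= f t)%E ->
  (forall t, f t <= (\sum_(k <- s) w k *
     \prod_(l < n) \1_(ball (a k 0 l) delta) (t 0 l))%:E)%E ->
  (iterated_integral D f <= (\sum_(k <- s) w k * (2 * delta) ^+ n)%:E)%E.
Proof.
move=> mD d0; elim: n w a f => [|n IH] w a f w0 f0 fle /=.
  apply: le_trans (fle _) _; rewrite lee_fin; apply: ler_sum => k _.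
  by rewrite big_ord0 expr0.
pose B k : set R := ball (a k 0 ord0) delta.
have mB k : measurable (B k) by exact: measurable_ball.
apply: (@le_trans _ _ (\int[@lebesgue_measure R]_(x in D)
  (\sum_(k <- s) ((w k * (2 * delta) ^+ n) * \1_(B k) x)%:E)))%E.
  apply: le_lower_integral => [x _|x _]; first exact: iterated_integral_ge0.
  rewrite sumEFin.
  apply: le_trans (IH (fun k => w k * \1_(B k) x)
    (fun k => \row_l a k 0 (lift ord0 l)) _ _ _ _) _ => //.
  - by move=> k; rewrite mulr_ge0// indicE.
  - move=> v; apply: le_trans (fle _) _; rewrite lee_fin.
    apply: ler_sum => k _; rewrite big_ord_recl -/(consv x v).
    rewrite consv0 mulrA.
    rewrite (eq_bigr (fun l => \1_(ball ((\row_l a k 0 (lift ord0 l)) 0 l) delta) (v 0 l)))//.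
    by move=> l _; rewrite consvS mxE.
  - rewrite lee_fin; apply: ler_sum => k _.
    by rewrite mulrAC.
have mI k : measurable_fun D
    (fun x => ((w k * (2 * delta) ^+ n) * \1_(B k) x)%:E).
  by apply/measurable_EFinP; apply: measurable_funM.
rewrite ge0_integral_sum//; last first.
  move=> k x _; rewrite lee_fin mulr_ge0// ?indicE//.
  by rewrite mulr_ge0// exprn_ge0// mulr_ge0.
rewrite -sumEFin; apply: lee_sum => k _.
have c0 : 0 <= w k * (2 * delta) ^+ n.
  by rewrite mulr_ge0// exprn_ge0// mulr_ge0.
under eq_integral do rewrite EFinM.
rewrite ge0_integralZl_EFin//; first last.
- by apply/measurable_EFinP; apply: measurable_indic; exact: mB.
- rewrite integral_indic//; last exact: mB.
  rewrite exprSr mulrA [leRHS]EFinM; apply: lee_wpmul2l; first by rewrite lee_fin.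
  apply: (@le_trans _ _ (@lebesgue_measure R (B k))).
    apply: le_measure; rewrite ?inE; [|exact: mB|exact: subIsetl].
    by apply: measurableI; [exact: mB|exact: mD].
  by rewrite /B lebesgue_measure_ball// mulr_natl.
Qed.

Lemma iterated_integral_ge_cube (R : realType) (a b c : R) (n : nat)
    (f : 'rV[R]_n -> \bar R) : a <= b -> 0 <= c -> (forall t, 0 <= f t)%E ->
  (forall t : 'rV[R]_n, (forall k, t 0 k \in `[a, b]) -> (c%:E <= f t)%E) ->
  ((c * (b - a) ^+ n)%:E <= iterated_integral `[a, b] f)%E.
Proof.
move=> ab c0; elim: n f => [|n IH] f f0 fc /=.
  by rewrite expr0 mulr1; apply: fc => -[].
apply: (@le_trans _ _ (\int[@lebesgue_measure R]_(x in `[a, b]) (c * (b - a) ^+ n)%:E)%E).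
  rewrite integral_cst//= lebesgue_measure_itv/= lte_fin.
  case: ltP => [ab'|ba]; first by rewrite -EFinB -EFinM exprSr mulrA.
  by rewrite mule0 (_ : b - a = 0) ?expr0n ?mulr0//; lra.
apply: le_lower_integral => x xab.
  by rewrite /= lee_fin mulr_ge0// exprn_ge0// subr_ge0.
apply: IH => // v vab; apply: fc => k.
rewrite -/(consv x v).
case: (unliftP ord0 k) => [l|] ->; first by rewrite consvS.
by rewrite consv0.
Qed.

(** * Volume of ellipsoids *)

Definition qform (R : realType) (n : nat) (G : 'M[R]_n) (u : 'rV[R]_n) : R :=
  (u *m G *m u^T) 0 0.

Definition posdef (R : realType) (n : nat) (G : 'M[R]_n) : Prop :=
  G^T = G /\ forall u : 'rV[R]_n, u != 0 -> 0 < qform G u.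

Lemma posdef_unit (R : realType) (n : nat) (G : 'M[R]_n) :
  posdef G -> G \in unitmx.
Proof.
move=> [_ pG]; rewrite -row_free_unit -kermx_eq0; apply/negPn/negP => K0.
have [i ri] : exists i, row i (kermx G) != 0.
  apply/existsP; rewrite -negb_forall; apply: contra K0 => /forallP r0.
  by apply/eqP/row_matrixP => i; rewrite (eqP (r0 i)) row0.
have := pG _ ri; rewrite /qform (_ : row i (kermx G) *m G = 0).
  by rewrite mul0mx mxE ltxx.
by apply: sub_kermxP; exact: row_sub.
Qed.

(** Completing the square in the last [n] coordinates: with [b] the upper right
block of [G], the shift is [z = b * G'^-1] and [s] is the Schur complement of
[G']. Both the form and its determinant split along this decomposition, in the
order in which [iterated_integral] integrates the coordinates. *)
Lemma posdef_schur (R : realType) (n : nat) (G : 'M[R]_(1 + n)) :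
  posdef G -> exists (G' : 'M[R]_n) (z : 'rV[R]_n) (s : R),
    [/\ posdef G', 0 < s, \det G = s * \det G' &
        forall y w, qform G (consv y w) = qform G' (w + y *: z) + s * y ^+ 2].
Proof.
move=> [symG pG].
pose a := ulsubmx G; pose b : 'rV[R]_n := ursubmx G; pose G' := drsubmx G.
have dlE : dlsubmx G = b^T by rewrite /b trmx_ursub symG.
have GE : G = block_mx a b b^T G' by rewrite -dlE submxK.
have symG' : G'^T = G' by rewrite /G' trmx_drsub symG.
have QE (x : 'rV[R]_1) w : x *m a *m x^T + x *m b *m w^T + w *m b^T *m x^T + w *m G' *m w^T
    = row_mx x w *m G *m (row_mx x w)^T.
  rewrite GE mul_row_block tr_row_mx mul_row_col !mulmxDl.
  by rewrite !addrA; congr (_ + _); rewrite addrAC.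
have pG' : posdef G'.
  split=> // u u0.
  have := pG (row_mx 0 u); rewrite /qform -QE !mul0mx trmx0 !mulmx0 !add0r; apply.
  by apply: contra u0; rewrite row_mx_eq0 => /andP[_].
have uG' := posdef_unit pG'.
pose z := b *m invmx G'.
have zG : z *m G' = b by rewrite /z mulmxKV.
have Gz : G' *m z^T = b^T by rewrite -[in RHS]zG [RHS]trmx_mul symG'.
pose s := a - z *m b^T.
have QE' y w : qform G (consv y w) = qform G' (w + y *: z) + s 0 0 * y ^+ 2.
  rewrite /qform /consv -QE.
  have -> : (const_mx y : 'rV[R]_1) = y%:M by apply/rowP => i; rewrite !mxE !ord1 mulr1n.
  rewrite !mul_scalar_mx !linearD /= !linearZ /= !tr_scalar_mx !mul_mx_scalar.
  rewrite !mulmxDl -!scalemxAl zG -[w *m G' *m z^T]mulmxA Gz.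
  have -> : b *m z^T = z *m b^T.
    by rewrite -[RHS]trmxK [in RHS]trmx_mul trmxK [RHS]mx11_scalar mxE -mx11_scalar.
  have wb : (w *m b^T) 0 0 = (b *m w^T) 0 0.
    by rewrite -[w *m b^T]trmxK trmx_mul trmxK mxE.
  rewrite /s; move: wb.
  set P := w *m b^T; set P' := b *m w^T; set Q := w *m G' *m w^T; set Z := z *m b^T.
  by rewrite !mxE => ->; ring.
exists G', z, (s 0 0); split => //.
- have := pG (consv 1 (- z)); rewrite QE' scale1r addNr /qform mul0mx mul0mx.
  rewrite mxE add0r expr1n mulr1; apply.
  apply/eqP => /(congr1 (fun M : 'rV[R]_(1 + n) => M 0 ord0)).
  by rewrite consv0 mxE => /eqP; rewrite oner_eq0.
- have : \det (G *m block_mx 1%:M 0 (- z^T) 1%:M) = s 0 0 * \det G'.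
    rewrite GE mulmx_block !mulmx0 !mulmx1 !add0r !mulmxN Gz subrr det_ublock.
    congr (_ * _); rewrite det_mx11; congr (fun_of_matrix _ _ _).
    rewrite /s; congr (_ - _).
    by rewrite -[LHS]trmxK [in LHS]trmx_mul trmxK [LHS]mx11_scalar mxE -mx11_scalar.
  by rewrite det_mulmx det_lblock !det1 !mulr1.
Qed.

Lemma posdef_det (R : realType) (n : nat) (G : 'M[R]_n) : posdef G -> 0 < \det G.
Proof.
elim: n G => [|n IH] G; first by rewrite det_mx00.
by move=> /(@posdef_schur _ n)[G' [z [s [pG' s0 -> _]]]]; rewrite mulr_gt0// IH.
Qed.

(** [k] is a lower bound for the volume of the unit ball of dimension [n], in the
form in which it applies to ellipsoids of half-width [e] and to integrands that
are only bounded below by [w] there. *)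
Definition ellipsoid_constant (R : realType) (n : nat) (k : R) : Prop :=
  forall (G : 'M[R]_n) (c : 'rV[R]_n) (e w : R) (f : 'rV[R]_n -> \bar R),
    posdef G -> 0 < e -> 0 <= w -> (forall t, 0 <= f t)%E ->
    (forall t, qform G (t - c) < e ^+ 2 -> (w%:E <= f t)%E) ->
    ((k * e ^+ n * w / Num.sqrt (\det G))%:E <= iterated_integral [set: R] f)%E.

(** A slice of the ellipsoid at a first coordinate close to that of the centre
contains an ellipsoid of the form [G'] given by completing the square, with
half-width [2 / 3 * e]; its centre moves with the slice, which does not affect
its volume. The factor [2 / 3] makes the two contributions to the form add up to
[8 / 9 * e ^+ 2]. *)
Lemma ellipsoid_volume_ge (R : realType) (n : nat) :
  exists2 k : R, 0 < k & ellipsoid_constant n k.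
Proof.
elim: n => [|n [k k0 IH]].
  exists 1 => // G c e w f pG e0 w0 f0 fw /=.
  rewrite det_mx00 sqrtr1 divr1 expr0 !mul1r; apply: fw.
  by rewrite /qform mxE big_ord0 exprn_gt0.
exists (k * (2 / 3) * (2 / 3) ^+ n); first by rewrite !mulr_gt0// ?exprn_gt0.
move=> G c e w f pG e0 w0 f0 fw.
have [G' [z [s [pG' s0 dG QG]]]] := @posdef_schur _ n _ pG.
have dG'0 := posdef_det pG'.
pose c0 : R := c 0 ord0; pose c' : 'rV[R]_n := rsubmx (c : 'rV[R]_(1 + n)).
have cE : c = consv c0 c'.
  apply/rowP => i; case: (unliftP ord0 i) => [l|] ->; last by rewrite consv0.
  by rewrite consvS mxE; congr (c _ _); exact: val_inj.
pose h := 2 / 3 * e / Num.sqrt s; have h0 : 0 < h by rewrite !mulr_gt0// invr_gt0 sqrtr_gt0.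
pose A : R := k * (2 / 3 * e) ^+ n * w / Num.sqrt (\det G').
have A0 : 0 <= A.
  by rewrite !mulr_ge0// ?(ltW k0)// ?invr_ge0 ?sqrtr_ge0// exprn_ge0// !mulr_ge0// ltW.
pose B : set R := ball (c0 : R) h.
have mB : measurable B by exact: measurable_ball.
apply: (@le_trans _ _ (\int[@lebesgue_measure R]_(x in setT)
    (A * \1_B x)%:E))%E; last first.
  apply: le_lower_integral => x _.
    by rewrite lee_fin mulr_ge0// indicE.
  rewrite indicE; case: (boolP (x \in _)) => [|_]; last first.
    by rewrite mulr0; exact: iterated_integral_ge0.
  rewrite inE /B /ball /= => xc; rewrite mulr1.
  apply: (IH G' (c' - (x - c0) *: z)) => //; first by rewrite !mulr_gt0.
  move=> t Qt; apply: fw; rewrite -/(consv x t).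
  have -> : consv x t - c = consv (x - c0) (t - c').
    apply/rowP => i; rewrite [LHS]mxE [X in _ + X]mxE [in LHS]cE.
    case: (unliftP ord0 i) => [l|] ->; last by rewrite !consv0.
    by rewrite !consvS [RHS]mxE [in RHS]mxE.
  have -> : qform G (consv (x - c0) (t - c')) =
      qform G' (t - (c' - (x - c0) *: z)) + s * (x - c0) ^+ 2.
    by rewrite QG opprB addrA addrAC.
  have : s * (x - c0) ^+ 2 < (2 / 3 * e) ^+ 2.
    have {}xc : `|x - c0| < h by rewrite distrC.
    have -> : (2 / 3 * e) ^+ 2 = s * h ^+ 2.
      rewrite /h expr_div_n sqr_sqrtr ?(ltW s0)//.
      by rewrite [RHS]mulrCA divff ?gt_eqF// mulr1.
    rewrite ltr_pM2l// -[_ ^+ 2]real_normK ?num_real//.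
    by rewrite ltr_pXn2r// nnegrE ?(ltW h0).
  move=> /(ltrD Qt)/lt_le_trans; apply.
  rewrite !exprMn; have := sqr_ge0 e; lra.
under eq_integral do rewrite EFinM.
rewrite ge0_integralZl_EFin//; first last.
  by apply/measurable_EFinP; exact: (@measurable_indic _ (measurableTypeR R) R setT B mB).
rewrite integral_indic//.
have lB : lebesgue_measure B = (h *+ 2)%:E by exact: lebesgue_measure_ball (ltW h0).
rewrite setIT; apply: (@le_trans _ _ (A%:E * (h *+ 2)%:E)%E); last by rewrite -lB.
rewrite -EFinM lee_fin.
rewrite dG sqrtrM ?(ltW s0)// /A /h.
rewrite [in leRHS]exprMn exprSr -[X in _ <= _ * X]mulr_natr invfM.
set q := Num.sqrt s; set q' := Num.sqrt _.
have q'0 : 0 < q'^-1 by rewrite invr_gt0 sqrtr_gt0.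
have q0 : 0 < q^-1 by rewrite invr_gt0 sqrtr_gt0.
set P := (2 / 3) ^+ n; set E := e ^+ n.
have P0 : 0 < P by rewrite exprn_gt0.
have E0 : 0 < E by rewrite exprn_gt0.
have : 0 <= k * P * E * e * w * q^-1 * q'^-1.
  by rewrite !mulr_ge0// ltW.
lra.
Qed.

(** * Quadratic forms near a positive definite one *)

Lemma qformE (R : realType) (n : nat) (G : 'M[R]_n) (u : 'rV[R]_n) :
  qform G u = \sum_k \sum_l u 0 l * G l k * u 0 k.
Proof.
rewrite /qform mxE; apply: eq_bigr => k _.
by rewrite !mxE mulr_suml.
Qed.

(** Cauchy-Schwarz for the inner product [G], against the vector [v] that
represents the coordinate [l]: [c] is the squared norm of [v]. *)
Lemma posdef_coord (R : realType) (n : nat) (G : 'M[R]_n) (l : 'I_n) :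
  posdef G -> exists2 c, 0 < c & forall u : 'rV[R]_n, (u 0 l) ^+ 2 <= c * qform G u.
Proof.
move=> pG; have uG := posdef_unit pG; case: (pG) => symG p0.
pose e : 'rV[R]_n := delta_mx 0 l; pose v := e *m invmx G.
have v0 : v != 0.
  apply/eqP => v0; have : e = 0 by rewrite -[e](mulmxKV uG) -/v v0 mul0mx.
  move/rowP => /(_ l); rewrite !mxE !eqxx => /eqP; rewrite oner_eq0//.
have c0 := p0 _ v0; exists (qform G v) => // u.
set c := qform G v in c0 *.
have Gv : G *m v^T = e^T by rewrite trmx_mul trmx_inv symG mulKVmx.
have vG : v *m G = e by rewrite mulmxKV.
have ul (w : 'rV[R]_n) : (w *m e^T) 0 0 = w 0 l.
  rewrite mxE (bigD1 l)//= big1 ?addr0 => [|i il]; rewrite !mxE ?eqxx ?mulr1//.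
  by rewrite (negbTE il) mulr0.
have lu (w : 'rV[R]_n) : (e *m w^T) 0 0 = w 0 l.
  by rewrite -[_ *m _]trmxK [in LHS]trmx_mul trmxK mxE ul.
have Q t : qform G (u - t *: v) = qform G u - 2 * t * u 0 l + t ^+ 2 * c.
  rewrite /c /qform [(u - t *: v)^T]linearB /= [(t *: v)^T]linearZ /= !mulmxBl !mulmxBr -!scalemxAl.
  rewrite -!scalemxAr -[u *m G *m v^T]mulmxA Gv vG.
  move: (ul u) (lu u); set X := u *m e^T; set Y := e *m u^T.
  set Z := e *m v^T; set W := u *m G *m u^T.
  by rewrite !mxE => -> ->; ring.
(* The coefficient [u 0 l / c] is that of the orthogonal projection of [u] on [v]. *)
have := Q (u 0 l / c).
have : 0 <= qform G (u - u 0 l / c *: v).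
  have [->|w0] := eqVneq (u - u 0 l / c *: v) 0; last exact: ltW (p0 _ w0).
  by rewrite /qform mul0mx mul0mx mxE.
move=> /[swap] ->.
have -> : qform G u - 2 * (u 0 l / c) * u 0 l + (u 0 l / c) ^+ 2 * c
    = (c * qform G u - u 0 l ^+ 2) / c by field; rewrite gt_eqF.
by rewrite pmulr_lge0 ?invr_gt0// subr_ge0.
Qed.

Lemma posdef_coords (R : realType) (n : nat) (G : 'M[R]_n) :
  posdef G ->
  exists2 c, 0 < c & forall (u : 'rV[R]_n) l, (u 0 l) ^+ 2 <= c * qform G u.
Proof.
move=> pG.
have Q0 u : 0 <= qform G u.
  have [->|w0] := eqVneq u 0; last by exact: ltW (pG.2 _ w0).
  by rewrite /qform mul0mx mul0mx mxE.
have /all_sig2[c c0 cP] (l : 'I_n) := cid2 (posdef_coord l pG).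
exists (1 + \sum_l c l); first by rewrite ltr_pwDl// sumr_ge0// => i _; exact: ltW.
move=> u l; apply: le_trans (cP l u) _; apply: ler_wpM2r => //.
rewrite (bigD1 l)//= addrCA lerDl addr_ge0// sumr_ge0// => i _; exact: ltW.
Qed.

(** A perturbation of [G] by less than [eta] in each entry changes the form by
at most [n ^ 2 * eta] times the largest squared coordinate, which is controlled
by the form itself. *)
Lemma qform_close (R : realType) (n : nat) (G : 'M[R]_n) :
  posdef G -> exists2 eta, 0 < eta & forall G' : 'M[R]_n,
    (forall k l, `|G' k l - G k l| < eta) ->
    forall u, qform G' u <= 2 * qform G u.
Proof.
move=> pG; have [c c0 cP] := posdef_coords pG.
pose eta := (c * (1 + n%:R * n%:R))^-1.
have N0 : 0 < 1 + n%:R * n%:R :> R by rewrite ltr_pwDl// mulr_ge0.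
exists eta; first by rewrite invr_gt0 mulr_gt0.
move=> G' GG' u; rewrite mulr_natl mulr2n -lerBlDl.
have eta0 : 0 < eta by rewrite invr_gt0 mulr_gt0.
have Q0 : 0 <= qform G u.
  have [->|w0] := eqVneq u 0; last by exact: ltW (pG.2 _ w0).
  by rewrite /qform mul0mx mul0mx mxE.
apply: (@le_trans _ _ (\sum_(k < n) \sum_(l < n) eta * (c * qform G u))).
  rewrite [qform G' u]qformE [X in _ - X <= _]qformE -sumrB; apply: ler_sum => k _.
  rewrite -sumrB; apply: ler_sum => l _.
  rewrite -mulrBl -mulrBr mulrAC.
  have := GG' l k; have := cP u l; have := cP u k.
  set x := u 0 l; set y := u 0 k; set B := c * _; set d := G' l k - _.
  move=> yB xB deta.
  have xy : `|x * y| <= B.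
    rewrite normrM; have := sqr_ge0 (`|x| - `|y|).
    rewrite -(real_normK (num_real x)) in xB; rewrite -(real_normK (num_real y)) in yB.
    by rewrite sqrrB; lra.
  apply: le_trans (ler_norm _) _; rewrite normrM mulrC.
  by apply: ler_pM => //; exact: ltW.
rewrite !sumr_const card_ord -mulr_natl -[X in _ * X]mulr_natl !mulrA.
rewrite -[leRHS]mul1r; apply: ler_wpM2r => //.
have -> : n%:R * n%:R * eta * c = (n%:R * n%:R) / (1 + n%:R * n%:R).
  by rewrite /eta; field; rewrite ?gt_eqF.
by rewrite ler_pdivrMr// mul1r lerDr.
Qed.

Lemma det_continuous_at (R : realType) (m n : nat) (F : 'rV[R]_m -> 'M[R]_n)
    (x : 'rV[R]_m) :
  (forall k l, {for x, continuous (fun v => F v k l)}) ->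
  {for x, continuous (fun v => \det (F v))}.
Proof.
move=> Fc; rewrite /determinant.
have FF : Filter (nbhs x) by exact: nbhs_filter.
have addc : continuous (fun z : R * R => z.1 + z.2).
  by move=> p; apply: cvgD; [exact: cvg_fst|exact: cvg_snd].
have mulc : continuous (fun z : R * R => z.1 * z.2).
  by move=> p; apply: cvgM; [exact: cvg_fst|exact: cvg_snd].
apply: (@cvg_big R _ _ _ _ addc _ _ _ _ _ FF) => s _.
apply: (@cvgM R); first exact: cvg_cst.
by apply: (@cvg_big R _ _ _ _ mulc _ _ _ _ _ FF) => i _; exact: Fc.
Qed.

(** * Small balls of a Riemannian manifold *)

Lemma is_derive_segment (R : realType) (n : nat) (v u : 'rV[R]_n) (t : R) :
  is_derive t 1 (fun s : R => v + s *: u) u.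
Proof.
have quotient : \forall h \near (0 : R)^',
    h^-1 *: (((fun s : R => v + s *: u) \o shift t) (h *: (1 : R^o)) - (v + t *: u)) = u.
  near=> h; have h0 : h != 0 by near: h; exact: nbhs_dnbhs_neq.
  rewrite /= opprD addrACA subrr add0r -scalerBl addrK scalerA [h *: 1]mulr1.
  by rewrite mulVf// scale1r.
apply: DeriveDef; first by apply/cvg_ex; exists u; exact: cvg_near_cst quotient.
by apply: (cvg_lim (@norm_hausdorff _ _)); exact: cvg_near_cst quotient.
Unshelve. all: by end_near. Qed.

(** The only geometric input on the distance: it is at most the length of the
path that is a straight segment in a chart. *)
Lemma dist_le_segment (R : realType) (m : nat) (M : riemannianType R m)
    (i : chart_index (atlas M)) (v w : 'rV[R]_m) (L : R) : 0 <= L ->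
  (forall t, t \in `[0, 1] -> chart_codom i (v + t *: (w - v))) ->
  (forall t, t \in `[0, 1] ->
     qform (gram (tensor M) i (v + t *: (w - v))) (w - v) <= L ^+ 2) ->
  mdist (param i v) (param i w) <= L.
Proof.
move=> L0 codom QL.
pose u := w - v; pose c (t : R) : 'rV[R]_m := v + t *: u.
have c'E : derive1 c = cst u.
  by apply/funext => t; rewrite derive1E; have [_] := is_derive_segment v u t.
have C1 : C1_curve_in i c.
  split => //; last by rewrite c'E; exact: cst_continuous.
  by move=> t; have [] := is_derive_segment v u t.
have := path_cat C1 (path_cst (tensor M) _).
rewrite /c scale0r addr0 scale1r subrKC addr0 => pathL.
rewrite -lee_fin mdistE.
apply: (@le_trans _ _ (curve_length (tensor M) i c)%:E).
  by apply: ereal_inf_lbound; exists (curve_length (tensor M) i c).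
rewrite lee_fin /curve_length /Rintegral.
set I := (X in fine X).
have IL : (I <= L%:E)%E.
  have <- : (\int[@lebesgue_measure R]_(t in `[0%R, 1%R]) L%:E = L%:E)%E.
    rewrite integral_cst//= lebesgue_measure_itv/= lte_fin ltr01.
    by rewrite -EFinB subr0 mule1.
  apply: le_lower_integral => t t01; first by rewrite lee_fin sqrtr_ge0.
  rewrite lee_fin c'E -(ger0_norm L0) -sqrtr_sqr ler_wsqrtr//.
  exact: QL.
have I0 : (0 <= I)%E by apply: integral_ge0 => t _; rewrite lee_fin sqrtr_ge0.
by rewrite -lee_fin fineK// ge0_fin_numE// (le_lt_trans IL)// ltry.
Qed.

(** In a chart around [y], the ball of radius [delta] around [x] contains the
ellipsoid of half-width [delta / 2] centred at [x] for the Gram matrix [G0] at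
[y], because along straight segments the squared speed is at most twice the one
measured by [G0]. On that ellipsoid the volume density is at least half the
density at [y]; the latter cancels against the determinant in the volume of the
ellipsoid, so that the constant depends on neither the point nor the metric. *)
Lemma local_small_ball_volume (R : realType) (m : nat) (k : R)
    (kP : ellipsoid_constant m k) (M : riemannianType R m) (y : M) :
  exists2 delta0, 0 < delta0 &
    \forall x \near y, forall delta, 0 < delta -> delta <= delta0 ->
      exists i, ((k / 2 * (delta / 2) ^+ m)%:E <=
        chart_volume (tensor M) i (ball x delta `&` dom i))%E.
Proof.
have [i iy] := dom_cover (atlas M) y.
pose g := tensor M; pose w := chart i y; pose G0 := gram g i w.
have cw : chart_codom i w by exists y.
have pG0 : posdef G0.
  by split; [exact: gram_sym|move=> u u0; exact: gram_posdef].
have [c c0 cP] := posdef_coords pG0.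
have [eta eta0 etaP] := qform_close pG0.
have dG0 := posdef_det pG0.
have gramc a b : {for w, continuous (fun v => gram g i v a b)}.
  by have [+ _] := @gram_smooth _ _ _ _ g i a b 0%N; apply.
have [rho rho0 rhoP] : exists2 rho, 0 < rho & forall v, ball w rho v ->
    [/\ chart_codom i v, forall a b, `|gram g i v a b - G0 a b| < eta &
        \det G0 / 4 <= \det (gram g i v)].
  suff : \forall v \near w, [/\ chart_codom i v,
      forall a b, `|gram g i v a b - G0 a b| < eta &
      \det G0 / 4 <= \det (gram g i v)].
    by move/nbhs_ballP => [rho rho0 rhoP]; exists rho.
  near=> v; split.
  - by near: v; apply: open_nbhs_nbhs; split => //; exact: codom_open.
  - suff : forall ab : 'I_m * 'I_m, `|gram g i v ab.1 ab.2 - G0 ab.1 ab.2| < eta.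
      by move=> H a b; exact: (H (a, b)).
    near: v; apply: filter_forall => -[a b] /=.
    have /cvgrPdist_lt/(_ _ eta0) := gramc a b.
    by apply: filterS => v; rewrite distrC.
  - near: v; have /cvgrPdist_lt/(_ (\det G0 * (3 / 4))) := det_continuous_at gramc.
    have d34 : 0 < \det G0 * (3 / 4) by rewrite mulr_gt0.
    move=> /(_ d34); apply: filterS => v /ltW; rewrite ler_norml => /andP[_].
    rewrite -/G0; lra.
(* This radius keeps the ellipsoid within [rho / 2] of its centre in each coordinate. *)
exists (rho / Num.sqrt c); first by rewrite divr_gt0// sqrtr_gt0.
have rho2 : 0 < rho / 2 by rewrite divr_gt0.
near=> x => delta delta0 delta_le; exists i.
have xi : dom i x by near: x; apply: open_nbhs_nbhs; split => //; exact: dom_open.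
have xw : ball w (rho / 2) (chart i x).
  by near: x; apply: (chart_continuous iy); exact: nbhsx_ballx.
have {}xw l : `|w 0 l - chart i x 0 l| < rho / 2 by case: xw => _ /(_ 0 l).
set v0 := chart i x in xw *.
pose e := delta / 2; have e0 : 0 < e by rewrite divr_gt0.
have e_le : c * e ^+ 2 <= (rho / 2) ^+ 2.
  have : delta ^+ 2 <= (rho / Num.sqrt c) ^+ 2.
    by rewrite ler_pXn2r// nnegrE ltW// (lt_le_trans delta0).
  rewrite expr_div_n sqr_sqrtr ?(ltW c0)// ler_pdivlMr// /e !expr_div_n; lra.
pose wt := Num.sqrt (\det G0) / 2.
have -> : k / 2 * (delta / 2) ^+ m = k * e ^+ m * wt / Num.sqrt (\det G0).
  by rewrite /wt; field; rewrite gt_eqF// sqrtr_gt0.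
apply: (kP G0 v0) => //.
  by rewrite divr_ge0 ?sqrtr_ge0.
move=> t Qt.
have tv l : `|t 0 l - v0 0 l| < rho / 2.
  rewrite -(@ltr_pXn2r _ 2)// ?nnegrE// ?(ltW rho2)// real_normK ?num_real//.
  have := cP (t - v0) l; rewrite !mxE => /le_lt_trans; apply.
  by apply: lt_le_trans e_le; rewrite ltr_pM2l.
have seg s : s \in `[0, 1] -> ball w rho (v0 + s *: (t - v0)).
  rewrite in_itv/= => /andP[s0 s1]; split => // a l; rewrite (ord1 a) /ball /=.
  rewrite !mxE opprD addrA (splitr rho).
  apply: le_lt_trans (ler_normB _ _) _; apply: ltrD; first exact: xw.
  rewrite normrM ger0_norm//; apply: le_lt_trans (tv l).
  by rewrite ler_piMl.
have [tc _ dt] : [/\ chart_codom i t, forall a b, `|gram g i t a b - G0 a b| < eta &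
        \det G0 / 4 <= \det (gram g i t)].
  apply: rhoP; have := seg 1; rewrite scale1r subrKC; apply.
  by rewrite in_itv/= ler01 lexx.
have dist_t : mdist x (param i t) < delta.
  (* The length is at most [sqrt 2 * e], and [sqrt 2 < 3 / 2 < 2]. *)
  apply: (@le_lt_trans _ _ (3 / 2 * e)); last by rewrite /e; lra.
  rewrite -(chartK xi) -/v0; apply: dist_le_segment; first by rewrite mulr_ge0// ltW.
    by move=> s s01; have [] := rhoP _ (seg _ s01).
  move=> s s01; have [_ /etaP gs _] := rhoP _ (seg _ s01).
  apply: le_trans (gs _) _; rewrite exprMn; have := sqr_ge0 e; lra.
have tE : (chart i @` (ball x delta `&` dom i)) t.
  case: tc => z zi zt; exists z => //; split => //.
  by rewrite ballEmdist /= -(chartK zi) zt.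
rewrite lee_fin indicE mem_set// mul1r /wt.
have -> : Num.sqrt (\det G0) / 2 = Num.sqrt (\det G0 / 4).
  rewrite sqrtrM ?(ltW dG0)// sqrtrV//; congr (_ / _).
  by rewrite (_ : 4 = 2 ^+ 2 :> R) ?sqrtr_sqr ?ger0_norm//; ring.
exact: ler_wsqrtr.
Unshelve. all: by end_near. Qed.

(** Compactness makes the radius uniform on the manifold; the constant [k] does
not even depend on the manifold. *)
Lemma small_ball_volume (R : realType) (m : nat) : exists2 k : R, 0 < k &
  forall M : riemannianType R m, compact [set: M] ->
  exists2 delta0, 0 < delta0 &
    forall (x : M) delta, 0 < delta -> delta <= delta0 ->
      exists i, ((k * delta ^+ m)%:E <=
        chart_volume (tensor M) i (ball x delta `&` dom i))%E.
Proof.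
have [k k0 kP] := ellipsoid_volume_ge R m.
exists (k / 2 / 2 ^+ m); first by rewrite !divr_gt0// exprn_gt0.
move=> M /compact_near_coveringP cM.
pose P (delta0 : R) (x : M) := forall delta, 0 < delta -> delta <= delta0 ->
  exists i, ((k / 2 * (delta / 2) ^+ m)%:E <=
        chart_volume (tensor M) i (ball x delta `&` dom i))%E.
have : \forall delta0 \near (0 : R)^'+, [set: M] `<=` P delta0.
  apply: cM => y _; have [d0 d0_gt0 yP] := local_small_ball_volume kP y.
  exists ([set x | P d0 x], [set d | d <= d0]) => /=.
    by split => //; exact: nbhs_right_le.
  by move=> [x d] [/= xP dd0] delta delta0 /le_trans/(_ dd0); exact: xP.
move=> PP.
have [d [d0 dP]] : exists d : R, 0 < d /\ [set: M] `<=` P d.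
  have : \forall d \near (0 : R)^'+, 0 < d /\ [set: M] `<=` P d.
    by near=> d; split; near: d => //; exact: nbhs_right_gt.
  by move/filter_ex.
exists d => // x delta delta0 /(dP x I _ delta0)[i ile]; exists i.
by move: ile; rewrite expr_div_n; congr (_ <= _)%E; congr EFin; ring.
Unshelve. all: by end_near. Qed.

(** * Counting balls that meet a sphere *)

Lemma tetra_h_bounds (R : realType) (m : nat) (X Xbar : metricType R)
    (j : X -> Xbar) (p : X) (q : 'I_m.-1 -> Xbar) (r : R) (t : 'rV[R]_m.-1) :
  0 <= r -> 0 <= tetra_h j p q r t /\
    (tetra_h j p q r t != 0 -> tetra_points j p q r t !=set0) /\
    tetra_h j p q r t <= 2 * r.
Proof.
move=> r0; rewrite /tetra_h; case: asboolP => [[x [y [Px Py xy]]]|_]; last first.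
  by rewrite lexx eqxx mulr_ge0.
set D := [set d | _].
have Dlb : lbound D 0 by move=> _ [a [b [_ _ _ ->]]]; exact: mdist_ge0.
have Dxy : D (mdist x y) by exists x, y.
split; first by apply: lb_le_inf; [exists (mdist x y)|exact: Dlb].
split; first by move=> _; exists x.
apply: (@le_trans _ _ (mdist x y)); first by apply: ge_inf => //; exists 0.
apply: le_trans (metric_triangle x p y) _.
by rewrite (metric_sym p y) Px.1 Py.1; lra.
Qed.

(** [tetra_h] is at least [C * r] on a cube of side [2 * beta * r]. *)
Lemma tetrahedral_integral (R : realType) (m : nat) (C beta : R)
    (X : metricType R) (p : X) (r : R) : (0 < m)%N -> 0 < C -> 0 < beta -> 0 < r ->
  tetrahedral_property m C beta p r -> integral_tetrahedral_property m C beta p r.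
Proof.
move=> m0 C0 b0 r0 [Xbar [j [q [cj bq hq]]]]; exists Xbar, j, q; split => //.
have -> : C * (2 * beta) ^+ m.-1 * r ^+ m =
    (C * r) * ((1 + beta) * r - (1 - beta) * r) ^+ m.-1.
  have -> : (1 + beta) * r - (1 - beta) * r = 2 * beta * r by ring.
  have -> : r ^+ m = r * r ^+ m.-1 by rewrite -exprS prednK.
  by rewrite [(2 * beta * r) ^+ _]exprMn; ring.
apply: iterated_integral_ge_cube.
- by have := mulr_gt0 b0 r0; lra.
- by rewrite mulr_ge0// ltW.
- by move=> t; rewrite lee_fin; have [] := tetra_h_bounds j p q t (ltW r0).
- by move=> t tP; rewrite lee_fin; exact: hq.
Qed.

Definition meets_sphere (R : realType) (X : metricType R) (p : X) (s delta : R)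
  (y : X) : bool := `[< exists2 x, mdist x p = s & mdist y x < delta >].

(** The map sending a point to its distances to the vertices of the tetrahedron
moves each coordinate by less than [delta] on a ball of radius [delta], so it
sends such a ball into a cube of side [2 * delta]. The cubes that come from the
balls meeting the sphere cover the parameters at which [tetra_h] does not vanish,
and [tetra_h] never exceeds [2 * s]. *)
Lemma sphere_covering_count (R : realType) (m : nat) (C beta : R)
    (X : metricType R) (p : X) (s delta : R) (net : seq X) : 0 <= s -> 0 <= delta ->
  (forall x, exists2 y, y \in net & mdist y x < delta) ->
  integral_tetrahedral_property m C beta p s ->
  C * (2 * beta) ^+ m.-1 * s ^+ m <=
    2 * s * (count (meets_sphere p s delta) net)%:R * (2 * delta) ^+ m.-1.
Proof.
move=> s0 d0 netP [Xbar [j [q [[isoj _ _] _ int_ge]]]].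
rewrite -lee_fin; apply: le_trans int_ge _.
have -> : 2 * s * (count (meets_sphere p s delta) net)%:R * (2 * delta) ^+ m.-1 =
    \sum_(y <- [seq y <- net | meets_sphere p s delta y]) 2 * s * (2 * delta) ^+ m.-1.
  by rewrite big_const_seq count_predT size_filter iter_addr_0 mulrAC mulr_natr.
have s20 : 0 <= 2 * s by rewrite mulr_ge0.
apply: (iterated_integral_le_cubes (w := fun=> 2 * s)
    (a := fun y => \row_l mdist (j y) (q l))) => //.
  by move=> t; rewrite lee_fin; have [] := tetra_h_bounds j p q t s0.
move=> t; rewrite lee_fin.
have [_ [hP h_le]] := tetra_h_bounds j p q t s0.
have term0 (y : X) : 0 <= 2 * s *
    \prod_(l < m.-1) \1_(ball ((\row_l mdist (j y) (q l)) 0 l) delta) (t 0 l).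
  by rewrite mulr_ge0// prodr_ge0// => l _; rewrite indicE.
have [->|/hP[x [xp xq]]] := eqVneq (tetra_h j p q s t) 0; first exact: sumr_ge0.
have [y ynet yx] := netP x.
have yK : y \in [seq y <- net | meets_sphere p s delta y].
  by rewrite mem_filter ynet andbT; apply/asboolP; exists x.
rewrite (big_rem y yK) /= -[leLHS]addr0 lerD ?sumr_ge0//.
rewrite big1 ?mulr1// => l _; rewrite indicE mem_set//= mxE -xq /ball /=.
apply: le_lt_trans yx; rewrite -(isoj y x) ler_norml.
have := metric_triangle (j y) (j x) (q l); have := metric_triangle (j x) (j y) (q l).
rewrite (metric_sym (j x) (j y)); lra.
Qed.

(** Spheres whose radii differ by at least [2 * delta] meet different balls of
radius [delta], so the counts for about [r / (4 * delta)] spheres add up. This is a discrete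
substitute for integrating the measures of the spheres over the radius. *)
Lemma ball_covering_count (R : realType) (n : nat) (C beta : R)
    (X : metricType R) (p : X) (r delta : R) (net : seq X) :
  0 < C -> 0 < beta -> 0 < delta -> 8 * delta <= r ->
  (forall x, exists2 y, y \in net & mdist y x < delta) ->
  (forall s, 0 < s -> s <= r -> integral_tetrahedral_property n.+1 C beta p s) ->
  C / 16 * (beta / 2) ^+ n * r ^+ n.+1 <=
    (count (fun y => mdist y p < 2 * r) net)%:R * delta ^+ n.+1.
Proof.
move=> C0 b0 d0 dr netP tetra.
have r0 : 0 < r by lra.
pose J := Num.truncn (r / (4 * delta)).
have d4 : 0 < 4 * delta by lra.
have rd0 : 0 <= r / (4 * delta) by rewrite divr_ge0// ltW.
have /andP[J_le J_gt] := truncn_itv rd0; rewrite -/J in J_le J_gt.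
rewrite ler_pdivlMr// in J_le; rewrite ltr_pdivrMr// -natr1 in J_gt.
pose s (j : 'I_J) := r / 2 + 2 * delta * j%:R.
have s_le j : s j <= r.
  have : (j%:R : R) <= J%:R by rewrite ler_nat ltnW.
  by rewrite /s => jJ; have := ler_wpM2l (ltW d0) jJ; lra.
have s_ge j : r / 2 <= s j by rewrite lerDl mulr_ge0// mulr_ge0// ltW.
have s0 j : 0 < s j by apply: lt_le_trans (s_ge j); lra.
pose K j := count (meets_sphere p (s j) delta) net.
have K_ge j : C / 2 * (beta * r / 2) ^+ n <= (K j)%:R * delta ^+ n.
  have := sphere_covering_count (ltW (s0 j)) (ltW d0) netP (tetra _ (s0 j) (s_le j)).
  rewrite /= exprS -/(K j) !exprMn => count_ge.
  have {}count_ge : C * beta ^+ n * s j ^+ n <= 2 * (K j)%:R * delta ^+ n.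
    have c0 : 0 < 2 ^+ n * s j by rewrite mulr_gt0// exprn_gt0.
    rewrite -(ler_pM2l c0); apply: le_trans (le_trans count_ge _); lra.
  have rs : (r / 2) ^+ n <= s j ^+ n.
    by apply: lerXn2r (s_ge j); rewrite nnegrE ltW// divr_gt0.
  have cb0 : 0 <= C * beta ^+ n by rewrite mulr_ge0 ?exprn_ge0// ltW.
  by have := ler_wpM2l cb0 rs; rewrite exprMn exprVn; lra.
(* A ball of the net meets at most one of the spheres of radii [s j]. *)
have KP : (\sum_j K j <= count (fun y => (mdist y p < 2 * r)%R) net)%N.
  rewrite -sum1_count [leqRHS]big_mkcond /=.
  have -> : (\sum_j K j = \sum_(y <- net) \sum_j (meets_sphere p (s j) delta y : nat))%N.
    rewrite exchange_big /=; apply: eq_bigr => j _.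
    by rewrite /K -sum1_count big_mkcond /=; apply: eq_bigr => y _; case: ifP.
  apply: leq_sum => y _.
  have [/existsP[j yj]|] := boolP [exists j, meets_sphere p (s j) delta y]; last first.
    by rewrite negb_exists => /forallP yN; rewrite big1// => j _; rewrite (negbTE (yN j)).
  move/asboolP: (yj) => [x xp yx].
  have -> : mdist y p < 2 * r.
    apply: le_lt_trans (metric_triangle y x p) _; rewrite xp.
    by have := s_le j; lra.
  rewrite (bigD1 j)//= yj big1// => j' j'j; apply/eqP; rewrite eqb0.
  apply/negP => /asboolP[x' x'p yx'].
  have : `|s j' - s j| < 2 * delta.
    rewrite -x'p -xp; have := metric_triangle x x' p; have := metric_triangle x' x p.
    have := metric_triangle x' y x; rewrite (metric_sym x x') (metric_sym x' y).
    by move=> *; rewrite ltr_norml; apply/andP; split; lra.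
  have -> : s j' - s j = 2 * delta * ((j' : nat)%:R - (j : nat)%:R) by rewrite /s; ring.
  rewrite normrM gtr0_norm ?mulr_gt0// gtr_pMr ?mulr_gt0//.
  apply/negP; rewrite -leNgt.
  have : (j' : nat) != j by [].
  rewrite neq_ltn => /orP[] jj.
    rewrite ler_normr; apply/orP; right; rewrite opprB lerBrDr.
    by rewrite addrC natr1 ler_nat.
  rewrite ler_normr; apply/orP; left; rewrite lerBrDr.
  by rewrite addrC natr1 ler_nat.
have {}KP : (\sum_j (K j)%:R) * delta ^+ n.+1 <=
    (count (fun y => mdist y p < 2 * r) net)%:R * delta ^+ n.+1.
  by apply: ler_wpM2r; [rewrite exprn_ge0// ltW|rewrite -natr_sum ler_nat].
apply: le_trans KP.
apply: (@le_trans _ _ (delta * \sum_(j < J) C / 2 * (beta * r / 2) ^+ n)); last first.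
  rewrite exprS mulrCA ler_wpM2l ?(ltW d0)// mulr_suml.
  by apply: ler_sum => j _; exact: K_ge.
rewrite sumr_const card_ord -[X in _ <= delta * X]mulr_natr.
set B := (beta * r / 2) ^+ n.
have -> : C / 16 * (beta / 2) ^+ n * r ^+ n.+1 = C / 16 * B * r.
  by rewrite /B exprS (_ : beta * r / 2 = beta / 2 * r) ?exprMn; [ring|lra].
have B0 : 0 <= C * B by rewrite mulr_ge0 ?exprn_ge0 ?divr_ge0 ?mulr_ge0// ltW.
have : r <= 8 * (delta * J%:R) by lra.
by move=> /(ler_wpM2l B0); lra.
Qed.

(** * Separated sets *)

Definition separated_seq (R : realType) (X : metricType R) (r : R) (s : seq X) : Prop :=
  uniq s /\ {in s &, forall x y, x != y -> r <= mdist x y}.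

(** A separated sequence of maximal length is a net. *)
Lemma separated_net (R : realType) (X : metricType R) (r : R) (N : nat) : 0 < r ->
  (forall s : seq X, separated_seq r s -> (size s <= N)%N) ->
  exists2 s : seq X, separated_seq r s & forall x, exists2 y, y \in s & mdist y x < r.
Proof.
move=> r0 bound.
pose P n : bool := `[< exists2 s : seq X, separated_seq r s & size s = n >].
have P0 : exists n, P n by exists 0%N; apply/asboolP; exists [::].
have PN n : P n -> (n <= N)%N by move=> /asboolP[s /bound + <-].
have [n /asboolP[s [us ss] sn] nmax] := ex_maxnP P0 PN.
exists s => // x; apply: contrapT => far.
have {}far y : y \in s -> r <= mdist y x.
  by move=> ys; rewrite leNgt; apply/negP => yx; apply: far; exists y.
suff /nmax : P n.+1 by rewrite ltnn.
apply/asboolP; exists (x :: s); last by rewrite /= sn.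
split.
  rewrite /= us andbT; apply/negP => /far; rewrite mdistxx leNgt r0//.
move=> y z; rewrite !inE => /predU1P[->|ys] /predU1P[->|zs]; last exact: ss.
- by rewrite eqxx.
- by move=> _; rewrite metric_sym; exact: far.
- by move=> _; exact: far.
Qed.

(** Disjoint open balls, each cut down to the domain of one chart, form a family
over which the volume is a supremum. *)
Lemma separated_volume (R : realType) (m : nat) (M : riemannianType R m)
    (delta v : R) (s : seq M) : separated_seq (2 * delta) s ->
  (forall x : M, exists i, (v%:E <=
     chart_volume (tensor M) i (ball x delta `&` dom i))%E) ->
  (((size s)%:R * v)%:E <= Vol M)%E.
Proof.
move=> [us ss] /choice[i iP].
pose x (k : 'I_(size s)) := tnth (in_tuple s) k.
have xs k : x k \in s by exact: (mem_tnth k (in_tuple s)).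
apply: (@le_trans _ _ (\sum_(k < size s)
    chart_volume (tensor M) (i (x k)) (ball (x k) delta `&` dom (i (x k))))%E).
  apply: (@le_trans _ _ (\sum_(k < size s) v%:E)%E); last exact: lee_sum.
  by rewrite sumEFin sumr_const card_ord mulr_natl.
apply: ereal_sup_ubound; exists (size s), (i \o x),
  (fun k => ball (x k) delta `&` dom (i (x k))); split => //.
- move=> k; apply: sub_sigma_algebra; apply: openI; last exact: dom_open.
  rewrite openE => y /=; rewrite ballEmdist /= => xy.
  apply/nbhs_ballP; exists (delta - mdist (x k) y); first by rewrite /= subr_gt0.
  move=> z; rewrite !ballEmdist /= ltrBrDl; apply: le_lt_trans.
  exact: metric_triangle.
- by move=> k z [].
- apply/trivIsetP => k l _ _ kl; apply/seteqP; split => // z [[]].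
  rewrite !ballEmdist /= => xz _ [lz _].
  have : x k != x l.
    by rewrite /x !(tnth_nth (x k)) nth_uniq.
  move/(ss _ _ (xs k) (xs l)).
  have := metric_triangle (x k) z (x l); rewrite (metric_sym z).
  by move=> ?; rewrite leNgt => /negP; apply; lra.
Qed.

(** Fix a [delta]-separated [delta]-net, where [delta] is small in terms of [M].
Each ball of radius [2 * r] around a point of [s] contains at least a multiple of
[(r / delta) ^+ m] points of the net by the covering estimate, these balls are
disjoint, and the whole net has at most a multiple of [V0 / delta ^+ m] points
because balls of radius [delta / 2] have volume at least a multiple of
[delta ^+ m]. The scale [delta], the only quantity that depends on [M], cancels.
*)
Lemma tetrahedral_packing (R : realType) (m : nat) (r0 beta C V0 : R) :
  (0 < m)%N -> 0 < beta -> 0 < C -> exists2 c, 0 < c &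
  forall M : riemannianType R m, compact [set: M] -> (Vol M <= V0%:E)%E ->
  (forall (p : M) r, 0 < r -> r <= r0 -> integral_tetrahedral_property m C beta p r) ->
  forall r (s : seq M), 0 < r -> r <= r0 -> separated_seq (4 * r) s ->
    (size s)%:R * (c * r ^+ m) <= V0.
Proof.
case: m => // n _ b0 C0.
have [k k0 kP] := small_ball_volume R n.+1.
pose kappa := C / 16 * (beta / 2) ^+ n.
have kappa0 : 0 < kappa by rewrite !mulr_gt0// exprn_gt0// divr_gt0.
exists (kappa * k / 2 ^+ n.+1); first by apply: divr_gt0; [exact: mulr_gt0|exact: exprn_gt0].
move=> M cM volM tetra r P r_gt0 r_le [uP sP].
have [delta0 delta0_gt0 deltaP] := kP M cM.
pose delta := Num.min (r / 8) delta0.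
have d0 : 0 < delta by rewrite lt_min delta0_gt0 divr_gt0.
have dr : 8 * delta <= r by have : delta <= r / 8 by [rewrite ge_min lexx]; lra.
pose v := k * (delta / 2) ^+ n.+1.
have v0 : 0 < v by rewrite mulr_gt0// exprn_gt0// divr_gt0.
have volsep (s : seq M) : separated_seq delta s -> (size s)%:R * v <= V0.
  move=> ss; rewrite -lee_fin; apply: le_trans volM.
  apply: (@separated_volume _ _ _ (delta / 2)).
    by rewrite mulrC divfK.
  move=> x; apply: deltaP; first by rewrite divr_gt0.
  have : delta <= delta0 by rewrite ge_min lexx orbT.
  by lra.
have [net snet netP] : exists2 s : seq M, separated_seq delta s &
    forall x, exists2 y, y \in s & mdist y x < delta.
  apply: (@separated_net _ _ _ (Num.truncn (V0 / v))) => // s /volsep.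
  by rewrite -ler_pdivlMr// => sv; rewrite truncn_ge_nat// (le_trans _ sv).
have cnt p := ball_covering_count C0 b0 d0 dr netP
  (fun s s0 sr => tetra p s s0 (le_trans sr r_le)).
rewrite -/kappa in cnt.
(* A point of the net lies within [2 * r] of at most one point of [P]. *)
have total : (\sum_(p <- P) count (fun y => (mdist y p < 2 * r)%R) net <= size net)%N.
  have -> : (\sum_(p <- P) count (fun y => (mdist y p < 2 * r)%R) net =
      \sum_(y <- net) \sum_(p <- P) ((mdist y p < 2 * r)%R : nat))%N.
    rewrite exchange_big /=; apply: eq_bigr => p _.
    by rewrite -sum1_count big_mkcond /=; apply: eq_bigr => y _; case: ifP.
  rewrite -sum1_size; apply: leq_sum => y _.
  have [/hasP[p pP yp]|/hasPn none] := boolP (has (fun p => mdist y p < 2 * r) P).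
    rewrite (big_rem p pP) /= yp big_seq big1// => q.
    rewrite mem_rem_uniq// inE => /andP[qp qP]; apply/eqP; rewrite eqb0; apply/negP => yq.
    have := sP _ _ qP pP qp; rewrite leNgt => /negP; apply.
    apply: le_lt_trans (metric_triangle q y p) _.
    by rewrite (metric_sym q); lra.
  by rewrite big_seq big1// => p /none /negbTE ->.
have := volsep _ snet; apply: le_trans.
have -> : (size P)%:R * (kappa * k / 2 ^+ n.+1 * r ^+ n.+1) =
    k / 2 ^+ n.+1 * \sum_(p <- P) kappa * r ^+ n.+1.
  by rewrite big_const_seq count_predT iter_addr_0 -[_ *+ size P]mulr_natl; ring.
rewrite /v expr_div_n.
have -> : (size net)%:R * (k * (delta ^+ n.+1 / 2 ^+ n.+1)) =
  k / 2 ^+ n.+1 * ((size net)%:R * delta ^+ n.+1) by ring.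
apply: ler_wpM2l; first by rewrite divr_ge0 ?exprn_ge0// ltW.
apply: (@le_trans _ _ (\sum_(p <- P)
    (count (fun y => (mdist y p < 2 * r)%R) net)%:R * delta ^+ n.+1)).
  by apply: ler_sum => p _; exact: cnt.
by rewrite -mulr_suml -natr_sum ler_wpM2r ?ler_nat// exprn_ge0// ltW.
Qed.

(** Points at distances [0], [r], [2 * r] and so on from a given point are
[r]-separated, and connectedness provides them up to the diameter. *)
Lemma connected_diameter (R : realType) (X : metricType R) (r : R) (N : nat) :
  0 < r -> connected [set: X] ->
  (forall s : seq X, separated_seq r s -> (size s <= N)%N) ->
  forall x y : X, mdist x y <= r * N%:R.
Proof.
move=> r0 cX bound x y; rewrite leNgt; apply/negP => far.
have fc : continuous (mdist x : X -> R).
  move=> z; apply/cvgrPdist_lt => e e0; apply/nbhs_ballP; exists e => // t.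
  rewrite ballEmdist /= => zt; apply: le_lt_trans zt.
  have := metric_triangle x t z; have := metric_triangle x z t.
  by rewrite (metric_sym t) ler_norml => *; apply/andP; split; lra.
have /connected_intervalP itv : connected (mdist x @` [set: X]).
  by apply: connected_continuous_connected => //; exact: continuous_subspaceT.
have /choice[z zP] (j : nat) : exists z, (j <= N)%N -> mdist x z = r * j%:R.
  have [jN|_] := leqP j N; last by exists x.
  suff [z _ zj] : (mdist x @` [set: X]) (r * j%:R) by exists z.
  apply: (itv 0 (mdist x y)); [by exists x; rewrite ?mdistxx|by exists y|].
  rewrite mulr_ge0 ?(ltW r0)//=; apply: le_trans (ltW far).
  by rewrite ler_pM2l// ler_nat.
have dz j k : (j <= N)%N -> (k <= N)%N -> j != k -> r <= mdist (z j) (z k).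
  wlog jk : j k / (j < k)%N.
    move=> H jN kN; rewrite neq_ltn => /orP[] jk.
      by apply: H => //; rewrite neq_ltn jk.
    by rewrite metric_sym; apply: H => //; rewrite neq_ltn jk.
  move=> jN kN _; have := metric_triangle x (z j) (z k); rewrite !zP//.
  have : r * (j%:R + 1) <= r * k%:R by rewrite ler_pM2l// natr1 ler_nat.
  by lra.
have inj : {in iota 0 N.+1 &, injective z}.
  move=> j k; rewrite !mem_iota /= !add0n !ltnS => jN kN zz; apply/eqP/negPn/negP => jk.
  by have := dz _ _ jN kN jk; rewrite zz mdistxx leNgt r0.
have /bound : separated_seq r (map z (iota 0 N.+1)).
  split; first by rewrite map_inj_in_uniq// iota_uniq.
  move=> _ _ /mapP[j + ->] /mapP[k + ->]; rewrite !mem_iota /= !add0n !ltnS => jN kN zz.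
  by apply: dz => //; apply: contra zz => /eqP ->.
by rewrite size_map size_iota ltnn.
Qed.

(** * Metric spaces from distance functions *)

Definition is_distance (R : realType) (T : Type) (d : T -> T -> R) : Prop :=
  [/\ forall x, d x x = 0, forall x y, d x y = 0 -> x = y,
      forall x y, d x y = d y x & forall y x z, d x z <= d x y + d y z].

(** An alias of [T] that carries the metric structure determined by [d]. *)
Definition metric_space_of (R : realType) (T : Type) (d : T -> T -> R)
  (dP : is_distance d) : Type := T.

HB.instance Definition _ (R : realType) (T : Type) (d : T -> T -> R)
  (dP : is_distance d) := gen_eqMixin (metric_space_of dP).
HB.instance Definition _ (R : realType) (T : Type) (d : T -> T -> R)
  (dP : is_distance d) := gen_choiceMixin (metric_space_of dP).
HB.instance Definition _ (R : realType) (T : Type) (d : T -> T -> R)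
  (dP : is_distance d) := @isMetric.Build R (metric_space_of dP) d
    (let: And4 H _ _ _ := dP in H) (let: And4 _ H _ _ := dP in H)
    (let: And4 _ _ H _ := dP in H) (let: And4 _ _ _ H := dP in H).

Lemma mdist_space_of (R : realType) (T : Type) (d : T -> T -> R)
  (dP : is_distance d) (x y : metric_space_of dP) : mdist x y = d x y.
Proof. by []. Qed.

(** * Gluing two metric spaces along a correspondence *)

(** The length of a shortest way from [x] to [y] that crosses from [X] to [Y]
once, between related points and at cost [eta]. *)
Definition cross_dist (R : realType) (X Y : metricType R) (rel : X -> Y -> Prop)
    (eta : R) (x : X) (y : Y) : R :=
  inf [set d | exists x' y', rel x' y' /\ d = mdist x x' + eta + mdist y' y].

Definition glue_dist (R : realType) (X Y : metricType R) (rel : X -> Y -> Prop)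
    (eta : R) (u v : X + Y) : R :=
  match u, v with
  | inl x, inl x' => mdist x x'
  | inr y, inr y' => mdist y y'
  | inl x, inr y => cross_dist rel eta x y
  | inr y, inl x => cross_dist rel eta x y
  end.

Lemma cross_dist_le (R : realType) (X Y : metricType R) (rel : X -> Y -> Prop)
    (eta : R) x y x' y' : 0 <= eta -> rel x' y' ->
  cross_dist rel eta x y <= mdist x x' + eta + mdist y' y.
Proof.
move=> eta0 xy'; apply: ge_inf; last by exists x', y'.
by exists 0 => _ [a [b [_ ->]]]; rewrite !addr_ge0// mdist_ge0.
Qed.

Lemma cross_dist_ge (R : realType) (X Y : metricType R) (rel : X -> Y -> Prop)
    (eta a : R) x y : (exists x' y', rel x' y') ->
  (forall x' y', rel x' y' -> a <= mdist x x' + eta + mdist y' y) ->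
  a <= cross_dist rel eta x y.
Proof.
move=> [x0 [y0 xy0]] H; apply: lb_le_inf.
  by exists (mdist x x0 + eta + mdist y0 y), x0, y0.
by move=> _ [x' [y' [xy' ->]]]; exact: H.
Qed.

(** A detour through the other space crosses twice; it costs [2 * eta], which
makes up for the distortion of the correspondence. *)
Lemma glue_is_distance (R : realType) (X Y : metricType R) (rel : X -> Y -> Prop)
    (eta : R) : 0 < eta -> (exists x y, rel x y) ->
  (forall x y x' y', rel x y -> rel x' y' ->
     `|mdist x x' - mdist y y'| <= 2 * eta) ->
  is_distance (glue_dist rel eta).
Proof.
move=> eta0 rel0 dist.
have eta0' := ltW eta0.
have cross_gt0 x y : 0 < cross_dist rel eta x y.
  apply: lt_le_trans eta0 _; apply: cross_dist_ge => // x' y' _.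
  have := mdist_ge0 x x'; have := mdist_ge0 y' y; lra.
have crossX x x1 y : cross_dist rel eta x y <= mdist x x1 + cross_dist rel eta x1 y.
  rewrite -lerBlDl; apply: cross_dist_ge => // x' y' xy'.
  have := cross_dist_le x y eta0' xy'; have := metric_triangle x x1 x'; lra.
have crossY x y y1 : cross_dist rel eta x y <= cross_dist rel eta x y1 + mdist y1 y.
  rewrite -lerBlDr; apply: cross_dist_ge => // x' y' xy'.
  have := cross_dist_le x y eta0' xy'; have := metric_triangle y' y1 y; lra.
have throughY x x1 y : mdist x x1 <= cross_dist rel eta x y + cross_dist rel eta x1 y.
  rewrite -lerBlDr; apply: cross_dist_ge => // a b ab.
  rewrite lerBlDr -lerBlDl; apply: cross_dist_ge => // a' b' ab'.
  have := dist _ _ _ _ ab ab'; rewrite ler_norml => /andP[_].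
  have := metric_triangle x a x1; have := metric_triangle a a' x1.
  have := metric_triangle b y b'.
  rewrite (metric_sym a' x1) (metric_sym y b'); lra.
have throughX x y y1 : mdist y y1 <= cross_dist rel eta x y + cross_dist rel eta x y1.
  rewrite -lerBlDr; apply: cross_dist_ge => // a b ab.
  rewrite lerBlDr -lerBlDl; apply: cross_dist_ge => // a' b' ab'.
  have := dist _ _ _ _ ab ab'; rewrite ler_norml => /andP[+ _].
  have := metric_triangle y b y1; have := metric_triangle b b' y1.
  have := metric_triangle a x a'.
  rewrite (metric_sym y b) (metric_sym a x); lra.
split.
- by move=> [x|y] /=; exact: mdistxx.
- move=> [x|y] [x'|y'] /=; [by move/mdist_positivity ->| | |by move/mdist_positivity ->].
    by move=> c0; have := cross_gt0 x y'; rewrite c0 ltxx.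
  by move=> c0; have := cross_gt0 x' y; rewrite c0 ltxx.
- by move=> [x|y] [x'|y'] //=; exact: metric_sym.
- move=> [b|b] [a|a] [c|c] //=.
  + exact: metric_triangle.
  + by rewrite (metric_sym b c) addrC; exact: crossX.
  + by rewrite (metric_sym a b) addrC.
  + exact: metric_triangle.
Qed.

Lemma gromov_hausdorff_le (R : realType) (X Y : metricType R)
    (rel : X -> Y -> Prop) (eta eps : R) : 0 < eta -> 0 <= eps ->
  (exists x y, rel x y) ->
  (forall x y x' y', rel x y -> rel x' y' ->
     `|mdist x x' - mdist y y'| <= 2 * eta) ->
  (forall x, exists x' y', rel x' y' /\ mdist x x' <= eps) ->
  (forall y, exists x' y', rel x' y' /\ mdist y' y <= eps) ->
  (gromov_hausdorff_dist X Y <= (eps + 2 * eta)%:E)%E.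
Proof.
move=> eta0 eps0 rel0 dist netX netY.
have gP := glue_is_distance eta0 rel0 dist.
pose Z : metricType R := metric_space_of gP.
pose f (x : X) : Z := inl x; pose g (y : Y) : Z := inr y.
apply: (@le_trans _ _ (hausdorff_dist (range f) (range g))).
  by apply: ereal_inf_lbound; exists Z, f, g; split.
apply: ereal_inf_lbound; exists (eps + 2 * eta) => //; split.
- by lra.
- move=> _ [x _ <-]; have [x' [y' [xy' xx']]] := netX x.
  exists (g y'); first by exists y'.
  rewrite mdist_space_of /=; have := cross_dist_le x y' (ltW eta0) xy'.
  by rewrite mdistxx; lra.
- move=> _ [y _ <-]; have [x' [y' [xy' yy']]] := netY y.
  exists (f x'); first by exists x'.
  rewrite mdist_space_of /=; have := cross_dist_le x' y (ltW eta0) xy'.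
  by rewrite mdistxx; lra.
Qed.

(** * Gromov's precompactness theorem *)

(** The limit is the supremum of the [c] such that [h] is at least [c] on a set
of the ultrafilter. *)
Lemma ultralimit (R : realType) (T : Type) (F : set_system T) (h : T -> R) (B : R) :
  UltraFilter F -> (forall t, `|h t| <= B) ->
  exists l, forall e, 0 < e -> F [set t | `|h t - l| < e].
Proof.
move=> UF hB; pose S := [set c | F [set t | c <= h t]].
have SB : has_sup S.
  split.
    exists (- B); rewrite /S /=; apply: filterS filterT => t _ /=.
    by have := hB t; rewrite ler_norml => /andP[].
  exists B => c /filter_ex[t /= ct]; apply: le_trans ct _.
  by have := hB t; rewrite ler_norml => /andP[].
exists (sup S) => e e0.
have [c Sc lc] := sup_adherent e0 SB.
have Fub : F (~` [set t | sup S + e <= h t]).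
  have [Se|//] := in_ultra_setVsetC [set t | sup S + e <= h t] UF.
  have := ub_le_sup SB.2 Se; lra.
apply: filterS (filterI Sc Fub) => t /= [ct /negP]; rewrite -ltNge => th.
by rewrite ltr_norml; apply/andP; split; lra.
Qed.

Lemma ultra_exists (T : Type) (I : finType) (F : set_system T) (A : I -> set T) :
  UltraFilter F -> (forall t, exists i, A i t) -> exists i, F (A i).
Proof.
move=> UF cover; apply: contrapT => none.
have : F [set t | forall i, ~ A i t].
  apply: filter_forall => i; have [FA|//] := in_ultra_setVsetC (A i) UF.
  by exfalso; apply: none; exists i.
by move=> /filter_ex[t tA]; have [i /tA] := cover t.
Qed.

Section function_space.
Context {R : realType} {A : Type} (a0 : A) (P : set (A -> R)) (B : R).
Hypothesis PB : forall f, P f -> forall a, `|f a| <= B.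

Definition sup_dist (f g : {f : A -> R | P f}) : R :=
  sup [set `|sval f a - sval g a| | a in [set: A]].

Lemma sup_dist_le f g e :
  (forall a, `|sval f a - sval g a| <= e) -> sup_dist f g <= e.
Proof.
move=> fg; apply: ge_sup; first by exists `|sval f a0 - sval g a0|, a0.
by move=> _ [a _ <-].
Qed.

Lemma le_sup_dist f g a : `|sval f a - sval g a| <= sup_dist f g.
Proof.
apply: ub_le_sup; last by exists a.
exists (B + B) => _ [b _ <-]; apply: le_trans (ler_normB _ _) _.
by apply: lerD; apply: PB; [exact: svalP|exact: svalP].
Qed.

Lemma sup_is_distance : is_distance sup_dist.
Proof.
split.
- move=> f; apply/eqP; rewrite eq_le; apply/andP; split.
    by apply: sup_dist_le => a; rewrite subrr normr0.
  by have := le_sup_dist f f a0; rewrite subrr normr0.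
- move=> f g fg; suff : sval f = sval g.
    move: f g {fg} => [f fP] [g gP] /= fg; case: g / fg in gP *.
    by congr exist; exact: Prop_irrelevance.
  apply/funext => a; apply/eqP; rewrite -subr_eq0 -normr_le0 -fg.
  exact: le_sup_dist.
- move=> f g; apply/eqP; rewrite eq_le; apply/andP; split.
    by apply: sup_dist_le => a; rewrite distrC; exact: le_sup_dist.
  by apply: sup_dist_le => a; rewrite distrC; exact: le_sup_dist.
- move=> g f h; apply: sup_dist_le => a.
  rewrite -(subrK (sval g a) (sval f a)) -addrA.
  by apply: le_trans (ler_normD _ _) _; apply: lerD; exact: le_sup_dist.
Qed.

End function_space.

Section limit_space.
Context {R : realType} {A : Type} (a0 : A) (d : A -> A -> R) (D : R).
Hypothesis dxx : forall a, d a a = 0.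
Hypothesis d_sym : forall a b, d a b = d b a.
Hypothesis d_tri : forall b a c, d a c <= d a b + d b c.
Hypothesis dD : forall a b, `|d a b| <= D.

(** The completion of the pseudometric space [(A, d)], realized as the closure of
the functions [d a] for uniform convergence. *)
Definition limit_functions : set (A -> R) :=
  [set f | forall e, 0 < e -> exists a, forall b, `|f b - d a b| <= e].

Lemma limit_functions_bounded f : limit_functions f -> forall b, `|f b| <= D + 1.
Proof.
move=> fP b; have [a /(_ b) fa] := fP 1 ltr01.
rewrite -(subrK (d a b) (f b)); apply: le_trans (ler_normD _ _) _.
by rewrite addrC; apply: lerD.
Qed.

Definition limit_space : metricType R :=
  metric_space_of (sup_is_distance a0 limit_functions_bounded).

Lemma kuratowski_proof a : limit_functions (d a).
Proof. by move=> e e0; exists a => b; rewrite subrr normr0 ltW. Qed.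

Definition kuratowski (a : A) : limit_space := exist _ (d a) (kuratowski_proof a).

Lemma row_dist_le a b c : `|d a c - d b c| <= d a b.
Proof.
have := d_tri b a c; have := d_tri a b c; rewrite (d_sym b a) ler_norml.
by move=> *; apply/andP; split; lra.
Qed.

Lemma mdist_kuratowski a b : mdist (kuratowski a) (kuratowski b) = d a b.
Proof.
apply/eqP; rewrite eq_le; apply/andP; split.
  by apply: sup_dist_le => // c; exact: row_dist_le.
have := le_sup_dist limit_functions_bounded (kuratowski a) (kuratowski b) b.
by rewrite /= dxx subr0; apply: le_trans; exact: ler_norm.
Qed.

Variables (N : nat -> nat) (net : forall k, 'I_(N k) -> A).
Hypothesis netP : forall k a, exists l, d a (net (k := k) l) <= k.+1%:R^-1.

Lemma limit_space_net k (f : limit_space) :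
  exists l, mdist (kuratowski (net (k := k) l)) f <= 2 * k.+1%:R^-1.
Proof.
have k0 : 0 < k.+1%:R^-1 :> R by rewrite invr_gt0.
have [a fa] := svalP f _ k0; have [l al] := netP k a.
exists l; apply: sup_dist_le => // b; rewrite distrC.
have -> : sval f b - sval (kuratowski (net l)) b =
  (sval f b - d a b) + (d a b - d (net l) b) by rewrite /= addrA subrK.
apply: le_trans (ler_normD _ _) _; rewrite mulr_natl mulr2n; apply: lerD => //.
exact: le_trans (row_dist_le _ _ _) al.
Qed.

(** A pointwise limit along an ultrafilter on a totally bounded space is
uniform: for every [k] one of the finitely many balls around the net belongs to
the ultrafilter. *)
Lemma limit_space_compact : compact [set: limit_space].
Proof.
rewrite compact_ultra => F UF _; have FF : Filter F by typeclasses eauto.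
have /choice[f fP] (b : A) : exists l, forall e, 0 < e ->
    F [set g : limit_space | `|sval g b - l| < e].
  apply: (@ultralimit _ _ F (fun g : limit_space => sval g b) (D + 1)) => g.
  exact: limit_functions_bounded (svalP g) b.
have close k : exists l, F [set g : limit_space | forall b,
    `|sval g b - d (net (k := k) l) b| <= 2 * k.+1%:R^-1].
  apply: ultra_exists => g; have [l lg] := limit_space_net k g; exists l => b.
  rewrite distrC; apply: le_trans lg.
  exact: (le_sup_dist limit_functions_bounded (kuratowski (net l)) g b).
(* The estimate passes to the pointwise limit [f]. *)
have fclose k l : F [set g : limit_space | forall b,
    `|sval g b - d (net (k := k) l) b| <= 2 * k.+1%:R^-1] ->
    forall b, `|f b - d (net l) b| <= 2 * k.+1%:R^-1.
  move=> Fl b; apply/ler_addgt0Pr => e e0.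
  have /filter_ex[g [/= /(_ b) gl gf]] := @filterI _ F FF _ _ Fl (fP b _ e0).
  rewrite -(subrK (sval g b) (f b)) -addrA addrC.
  by apply: le_trans (ler_normD _ _) _; apply: lerD => //; rewrite distrC ltW.
have small (e : R) : 0 < e -> exists k : nat, 4 * k.+1%:R^-1 < e.
  move=> e0; exists (Num.truncn (4 / e)); rewrite ltr_pdivrMr// mulrC.
  by rewrite -ltr_pdivrMr//; have /andP[] := truncn_itv (ltW (divr_gt0 (ltr0n R 4) e0)).
have fL : limit_functions f.
  move=> e e0; have [k ke] := small e e0; have [l Fl] := close k.
  exists (net l) => b; apply: le_trans (fclose _ _ Fl b) _.
  by apply: le_trans (ltW ke); rewrite ler_pM2r ?invr_gt0// ler_nat.
pose y : limit_space := exist _ f fL.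
exists y; split => // U /nbhs_ballP[e /= e0]; rewrite ballEmdist => eU.
apply: (@filterS _ F FF _ _ eU).
have [k ke] := small e e0; have [l Fl] := close k.
apply: (@filterS _ F FF _ _ _ Fl) => g /= gl.
apply: le_lt_trans ke; apply: sup_dist_le => // b.
have -> : sval y b - sval g b = (f b - d (net l) b) - (sval g b - d (net l) b).
  by rewrite /= opprB addrA subrK.
apply: le_trans (ler_normB _ _) _.
by move: (fclose _ _ Fl b) (gl b); move: (k.+1%:R^-1 : R) => q; lra.
Qed.

End limit_space.

(** In each [X i] the points of finite nets at the scales [1 / (k + 1)] are
numbered by [A = nat * nat], the pair [(k, l)] being the [l]-th point of the
[k]-th net; the bounds on the numbers of points do not depend on [i]. The limit
[d] of the distances between these points along an ultrafilter defines the limit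
space. Sets of the ultrafilter are infinite, so a subsequence can be extracted
along which the distances within the [n]-th net are [1 / (n + 1)]-close to their
limit. *)
Lemma gromov_precompactness (R : realType) (X : nat -> metricType R) (D : R) :
  (forall i, [set: X i] !=set0) -> (forall i (x y : X i), mdist x y <= D) ->
  (forall e : R, 0 < e -> exists N, forall i (s : seq (X i)),
     separated_seq e s -> (size s <= N)%N) ->
  exists (s : nat -> nat) (Y : metricType R),
    {homo s : a b / (a < b)%N} /\ gromov_hausdorff_cvg (fun n => X (s n)) Y.
Proof.
move=> X0 XD bound.
have [p _] : {p : forall i, X i & True}.
  by exists (fun i => projT1 (cid (X0 i))).
have eps0 k : 0 < k.+1%:R^-1 :> R by rewrite invr_gt0.
have /choice[N NP] := fun k => bound _ (eps0 k).
pose A : Type := (nat * nat)%type.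
have /all_sig[x xP] (i : nat) : {x : A -> X i |
    forall k z, exists l : 'I_(N k).+1, mdist (x (k, l : nat)) z < k.+1%:R^-1}.
  apply: cid.
  have /choice[s sP] (k : nat) : exists s : seq (X i), (size s <= N k)%N /\
      forall z, exists2 y, y \in s & mdist y z < k.+1%:R^-1.
    have [s ss net] := separated_net (eps0 k) (NP k i).
    by exists s; split => //; exact: NP ss.
  (* Numbers beyond the size of a net stand for the base point [p i]. *)
  exists (fun a => nth (p i) (s a.1) a.2) => k z.
  have [sk] := sP k; move=> /(_ z)[y ys yz].
  have idx : (index y (s k) < (N k).+1)%N.
    by rewrite ltnS (leq_trans _ sk)// ltnW// index_mem.
  by exists (Ordinal idx); rewrite /= nth_index.
have [U [UU ooU]] := ultraFilterLemma (@eventually_filter).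
have UF : Filter U by typeclasses eauto.
pose di (ab : A * A) i := mdist (x i ab.1) (x i ab.2).
have diD ab i : `|di ab i| <= D by rewrite ger0_norm ?mdist_ge0//; exact: XD.
have /choice[dinf dinfP] (ab : A * A) : exists l, forall e, 0 < e ->
    U [set i | `|di ab i - l| < e] by exact: ultralimit (diD ab).
pose d a b := dinf (a, b).
have d_close a b e : 0 < e -> U [set i | `|mdist (x i a) (x i b) - d a b| < e].
  exact: (dinfP (a, b)).
have dxx a : d a a = 0.
  apply/eqP; rewrite -normr_le0; apply/ler_addgt0Pr => e e0.
  have /filter_ex[i /=] := d_close a a e e0.
  by rewrite mdistxx sub0r normrN add0r => /ltW.
have d_sym a b : d a b = d b a.
  apply/eqP; rewrite -subr_eq0 -normr_le0; apply/ler_addgt0Pr => e e0.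
  have e2 : 0 < e / 2 by rewrite divr_gt0.
  have /filter_ex[i [/=]] := @filterI _ U UF _ _ (d_close a b _ e2) (d_close b a _ e2).
  rewrite (metric_sym (x i b)) !ltr_norml => /andP[? ?] /andP[? ?].
  by rewrite add0r ler_norml; apply/andP; split; lra.
have d_tri b a c : d a c <= d a b + d b c.
  apply/ler_addgt0Pr => e e0.
  have e3 : 0 < e / 3 by rewrite divr_gt0.
  have /filter_ex[i [[/=]]] := @filterI _ U UF _ _ (@filterI _ U UF _ _
    (d_close a b _ e3) (d_close b c _ e3)) (d_close a c _ e3).
  rewrite !ltr_norml => /andP[? ?] /andP[? ?] /andP[? ?].
  by have := metric_triangle (x i a) (x i b) (x i c); lra.
have dD a b : `|d a b| <= D.
  apply/ler_addgt0Pr => e e0; have /filter_ex[i /=] := d_close a b e e0.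
  have := diD (a, b) i; rewrite /di /= ler_norml ltr_norml => /andP[? ?] /andP[? ?].
  by rewrite ler_norml; apply/andP; split; lra.
pose net k (l : 'I_(N k).+1) : A := (k, l : nat).
have netP k a : exists l : 'I_(N k).+1, d a (net k l) <= k.+1%:R^-1.
  have [l Ul] := @ultra_exists _ _ U (fun (l : 'I_(N k).+1) =>
    [set i | mdist (x i (net k l)) (x i a) < k.+1%:R^-1]) UU (fun i => xP i k _).
  exists l; apply/ler_addgt0Pr => e e0.
  have /filter_ex[i [/=]] := @filterI _ U UF _ _ Ul (d_close a (net k l) e e0).
  rewrite metric_sym ltr_norml => + /andP[+ _].
  by move: (k.+1%:R^-1 : R) => q; lra.
pose Y := limit_space (0%N, 0%N) dD.
pose K : A -> Y := kuratowski (0%N, 0%N) dD.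
have KE a b : mdist (K a) (K b) = d a b by exact: mdist_kuratowski.
(* [good n i]: the [n]-th nets of [X i] and of the limit space nearly match. *)
pose good n i := forall l l' : 'I_(N n).+1,
  `|mdist (x i (net n l)) (x i (net n l')) - d (net n l) (net n l')| < n.+1%:R^-1.
have goodU n : U (good n).
  have Ull : U [set i | forall ll : 'I_(N n).+1 * 'I_(N n).+1,
      `|mdist (x i (net n ll.1)) (x i (net n ll.2)) - d (net n ll.1) (net n ll.2)|
        < n.+1%:R^-1].
    by apply: filter_forall => ll; exact: d_close.
  by apply: (@filterS _ U UF _ _ _ Ull) => i /= H l l'; exact: (H (l, l')).
have /choice[next nextP] (nj : nat * nat) : exists i, (nj.2 < i)%N /\ good nj.1 i.
  have : U [set i | (nj.2 < i)%N] by apply: ooU; exists nj.2.+1.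
  by move=> /(@filterI _ U UF _ _)/(_ (goodU nj.1))/filter_ex[i []]; exists i.
pose s := fix s n := if n is n'.+1 then next (n, s n') else next (0%N, 0%N).
have s_good n : good n (s n).
  by case: n => [|n]; [exact: (nextP (0%N, 0%N)).2|exact: (nextP (n.+1, s n)).2].
exists s, Y; split.
  by apply: homo_ltn => [a b c|n] /=; [exact: ltn_trans|have [] := nextP (n.+1, s n)].
split; first exact: (limit_space_compact d_sym d_tri netP).
have GH n : (gromov_hausdorff_dist (X (s n)) Y <= (4 * harmonic n)%:E)%E.
  rewrite (_ : 4 * harmonic n = 2 * n.+1%:R^-1 + 2 * n.+1%:R^-1); last first.
    by rewrite /=; move: (n.+1%:R^-1 : R) => q; ring.
  apply: (@gromov_hausdorff_le _ _ _ (fun a b => exists l : 'I_(N n).+1,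
    a = x (s n) (net n l) /\ b = K (net n l))) => //.
  - by exists (x (s n) (net n ord0)), (K (net n ord0)), ord0.
  - move=> _ _ _ _ [l [-> ->]] [l' [-> ->]]; rewrite KE.
    apply: le_trans (ltW (s_good n l l')) _.
    by rewrite ler_peMl// ?ler1n// ltW.
  - move=> z; have [l lz] := xP (s n) n z.
    exists (x (s n) (net n l)), (K (net n l)); split; first by exists l.
    by rewrite metric_sym (le_trans (ltW lz))// ler_peMl// ?ler1n// ltW.
  - move=> y; have [l ly] := limit_space_net d_sym d_tri netP n y.
    by exists (x (s n) (net n l)), (K (net n l)); split; first by exists l.
apply: (@squeeze_cvge _ _ _ _ (cst 0%E) _ (fun n => (4 * harmonic n)%:E)).
- apply: nearW => n /=; rewrite GH andbT.
  apply: le_ereal_inf_tmp => _ [Z [f [g [_ _ ->]]]].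
  by apply: le_ereal_inf_tmp => _ [e [e0 _ _] <-]; rewrite lee_fin ltW.
- exact: cvg_cst.
- apply: cvg_EFin; first exact: nearW.
  rewrite -[X in _ --> X](mulr0 (4 : R)); apply: cvgM; [exact: cvg_cst|exact: cvg_harmonic].
Qed.

(** * Manifolds with the tetrahedral property *)

Theorem theorem1p4 (R : realType) (m : nat) (m_ge2 : (2 <= m)%N)
    (r0 beta C V0 : R) (r0_gt0 : 0 < r0) (beta_gt0 : 0 < beta)
    (beta_lt1 : beta < 1) (C_gt0 : 0 < C) (V0_gt0 : 0 < V0) :
  exists D : R,
  forall (D0 : R) (D0_gt0 : 0 < D0) (M : nat -> riemannianType R m)
    (M_compact : forall i, compact [set: M i])
    (M_vol : forall i, (Vol (M i) <= V0%:E)%E)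
    (M_diam : forall i, (Diam (M i) <= D0%:E)%E)
    (M_tetra :
      (forall i (p : M i) (r : R), 0 < r -> r <= r0 ->
         tetrahedral_property m C beta p r) \/
      (forall i (p : M i) (r : R), 0 < r -> r <= r0 ->
         integral_tetrahedral_property m C beta p r)),
    (exists (s : nat -> nat) (Y : metricType R),
       {homo s : a b / (a < b)%N} /\
       gromov_hausdorff_cvg (fun n => M (s n)) Y) /\
    (forall i, (Diam (M i) <= D%:E)%E).
Proof.
have m0 : (0 < m)%N by exact: ltnW.
have [c c0 packing] := tetrahedral_packing r0 V0 m0 beta_gt0 C_gt0.
pose N (r : R) := Num.truncn (V0 / (c * r ^+ m)).
(* [N r] bounds the size of a [4 * r]-separated sequence. *)
exists (4 * r0 * (N r0)%:R) => D0 D0_gt0 M M_compact M_vol M_diam M_tetra.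
have tetra i (p : M i) r : 0 < r -> r <= r0 -> integral_tetrahedral_property m C beta p r.
  move=> r_gt0 r_le; case: M_tetra => [H|H]; last exact: H.
  by apply: tetrahedral_integral => //; exact: H.
have bound r : 0 < r -> r <= r0 -> forall i (s : seq (M i)),
    separated_seq (4 * r) s -> (size s <= N r)%N.
  move=> r_gt0 r_le i s /(packing _ (M_compact i) (M_vol i) (tetra i) _ _ r_gt0 r_le).
  have cr0 : 0 < c * r ^+ m by rewrite mulr_gt0// exprn_gt0.
  rewrite -ler_pdivlMr// => sV; rewrite truncn_ge_nat//.
  by rewrite divr_ge0// ltW.
have diam i (x y : M i) : mdist x y <= 4 * r0 * (N r0)%:R.
  apply: connected_diameter; first by rewrite mulr_gt0.
    exact: carrier_connected.
  exact: bound.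
split; last by move=> i; apply: ge_ereal_sup => _ [x [y ->]]; rewrite lee_fin.
apply: gromov_precompactness diam _ => [i|e e0]; first exact: carrier_nonempty.
pose r := Num.min r0 (e / 4).
have r_gt0 : 0 < r by rewrite lt_min r0_gt0 divr_gt0.
have r_le : r <= r0 by rewrite ge_min lexx.
exists (N r) => i s [us ss]; apply: bound => //; split => // x y xs ys xy.
apply: le_trans (ss _ _ xs ys xy).
have : r <= e / 4 by rewrite ge_min lexx orbT.
lra.
Qed.
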